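(* Let $X$ be a standard Borel space, and consider the dynamical system $D:S_\infty\to\mathsf{BorelStoch}$ acting on $X^{\mathbb{N}}$ by finite permutations of the components. Let $p$ be an exchangeable probability measure on $X^{\mathbb{N}}$, inducing a dynamical system $D':S_\infty\to\mathsf{PS(BorelStoch)}$ acting on $(X^{\mathbb{N}},p)$. Let $\ell=\mathrm{samp}^{\mathbb{N}}\circ\mathrm{copy}_{\mathbb{N}}:PX\to X^{\mathbb{N}}$ be the Markov kernel sending $q\in PX$ to the infinite product measure $q^{\otimes\mathbb{N}}$. Then: \begin{itemize} \item There is a unique probability measure $\mu$ on $PX$ such that $\ell\circ\mu=p$. \item The limit of $D'$ in $\mathsf{PS(BorelStoch)}$ is given by $(PX,\mu)$, with limiting cone (the equivalence class of) the composite $$(PX,\mu)\xrightarrow{\ \mathrm{copy}_{\mathbb{N}}\ }\big((PX)^{\mathbb{N}},\mathrm{copy}_{\mathbb{N}}\circ\mu\big)\xrightarrow{\ \mathrm{samp}^{\mathbb{N}}\ }(X^{\mathbb{N}},p),$$ i.e. $\ell:(PX,\mu)\to(X^{\mathbb{N}},p)$. \end{itemize}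
   Context: $\mathsf{BorelStoch}$ is the category of standard Borel spaces and Markov kernels: a kernel $k:X\to Y$ assigns to $x\in X$ and measurable $B\subseteq Y$ a number $k(B|x)\in[0,1]$, being a probability measure in $B$ and measurable in $x$; composition is $(h\circ k)(C|x)=\int_Y h(C|y)\,k(dy|x)$. A probability measure $\mu$ on $X$ is identified with a kernel $1\to X$, so $(k\circ\mu)(B)=\int_X k(B|x)\,\mu(dx)$. For a probability measure $p$ on $X$, kernels $f,g:X\to Y$ are $p$-almost surely equal, $f\simeq_p g$, if $\int_A f(B|x)\,p(dx)=\int_A g(B|x)\,p(dx)$ for all measurable $A,B$. $\mathsf{PS(BorelStoch)}$ has standard Borel probability spaces as objects; morphisms $(X,p)\to(Y,q)$ are $p$-a.s. equality classes of kernels $f:X\to Y$ with $f\circ p=q$. $PX$ is the (standard Borel) space of probability measures on $X$, with $\sigma$-algebra generated by the evaluations $q\mapsto q(B)$. $X^{\mathbb{N}}$ is the countably infinite product. $\mathrm{copy}_{\mathbb{N}}:PX\to(PX)^{\mathbb{N}}$ is the deterministic kernel $q\mapsto(q,q,\dots)$, and $\mathrm{samp}^{\mathbb{N}}:(PX)^{\mathbb{N}}\to X^{\mathbb{N}}$ is the kernel $(q_i)_i\mapsto\bigotimes_i q_i$ (product measure). $S_\infty$ is the group of finite permutations of $\mathbb{N}$, acting deterministically on $X^{\mathbb{N}}$ by permuting components; $p$ on $X^{\mathbb{N}}$ is exchangeable if it is invariant under this action. A dynamical system acting on an object of a category is a functor from a monoid (as a one-object category) with that object as its value; its limit in $\mathsf{PS(BorelStoch)}$,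 for a system acting on $(Z,p)$, is an object $(L,\lambda)$ with a morphism $\ell:(L,\lambda)\to(Z,p)$ such that $m\circ\ell\simeq_\lambda\ell$ for all $m$, and such that for every morphism $g:(Y,q)\to(Z,p)$ with $m\circ g\simeq_q g$ for all $m$ there is a unique (up to $q$-a.s. equality) morphism $\tilde g:(Y,q)\to(L,\lambda)$ with $\ell\circ\tilde g\simeq_q g$. *)

(* Defs.v *)
From HB Require Import structures.
From mathcomp Require Import all_boot all_order all_algebra.
From mathcomp Require Import all_classical all_reals all_analysis.
From mathcomp Require Import measurable_realfun.

Set Implicit Arguments.
Unset Strict Implicit.
Unset Printing Implicit Defensive.
Import Order.TTheory GRing.Theory Num.Theory.
Import numFieldNormedType.Exports.

Local Open Scope classical_set_scope.
Local Open Scope ring_scope.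
Local Open Scope ereal_scope.

(* T is isomorphic, as a measurable space, to the Borel space of a Polish
   space S. A measurableType is inhabited by definition, so the empty standard
   Borel space is left out. *)
Definition standard_borel (R : realType) d (T : measurableType d) : Prop :=
  exists (S : completePseudoMetricType R) (f : T -> S),
    [/\ hausdorff_space S,
        (exists2 D : set S, countable D & dense D),
        bijective f &
        d.-measurable = preimage_set_system setT f <<s [set U : set S | open U] >>].

Section kernels.
Context d1 d2 d3 (X : measurableType d1) (Y : measurableType d2)
  (Z : measurableType d3) (R : realType).

Definition kid : R.-pker X ~> X := kdirac (@measurable_id _ X setT).

Definition kapp (k : R.-pker X ~> Y) (mu : probability X R) (B : set Y) :
  \bar R := \int[mu]_x k x B.

Definition pcomp (h : R.-pker Y ~> Z) (k : R.-pker X ~> Y) :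
  X -> {measure set Z -> \bar R} := mkcomp_noparam k h.

Variables (h : R.-pker Y ~> Z) (k : R.-pker X ~> Y).

Lemma pcompE x C : pcomp h k x C = \int[k x]_y h y C.
Proof. by []. Qed.

HB.instance Definition _ := Kernel.on (pcomp h k).

Let pcomp_prob x : pcomp h k x setT = 1.
Proof.
rewrite pcompE; under eq_integral do rewrite prob_kernel.
by rewrite integral_cst// mul1e prob_kernel.
Qed.

HB.instance Definition _ :=
  Kernel_isProbability.Build _ _ _ _ _ (pcomp h k) pcomp_prob.

Definition as_eq (p : probability X R) (f g : R.-pker X ~> Y) : Prop :=
  forall A B, measurable A -> measurable B ->
    \int[p]_(x in A) f x B = \int[p]_(x in A) g x B.

End kernels.
Arguments kid {d1 X R}.

Section ps.
Context (R : realType).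

(* f : (X, p) -> (Y, q) preserves the measures; a morphism of PS(BorelStoch)
   is an as_eq-class of such kernels and is handled through representatives. *)
Definition ps_hom d1 d2 (X : measurableType d1) (Y : measurableType d2)
    (p : probability X R) (q : probability Y R) (f : R.-pker X ~> Y) : Prop :=
  forall B, measurable B -> kapp f p B = q B.

(* a functor from the one-object category M to PS(BorelStoch), with value (Z, p) *)
Definition ps_dyn_system (M : monoidType) d (Z : measurableType d)
    (p : probability Z R) (D : M -> R.-pker Z ~> Z) : Prop :=
  [/\ standard_borel R Z,
      (forall m, ps_hom p p (D m)),
      as_eq p (D 1%g) kid &
      (forall m n, as_eq p (D (m * n)%g) (pcomp (D m) (D n)))].

Definition ps_cone (M : monoidType) d d' (Z : measurableType d)
    (p : probability Z R) (D : M -> R.-pker Z ~> Z)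
    (Y : measurableType d') (q : probability Y R) (g : R.-pker Y ~> Z) : Prop :=
  [/\ standard_borel R Y, ps_hom q p g &
      forall m, as_eq q (pcomp (D m) g) g].

Definition ps_limit (M : monoidType) d d' (Z : measurableType d)
    (p : probability Z R) (D : M -> R.-pker Z ~> Z)
    (L : measurableType d') (lam : probability L R) (l : R.-pker L ~> Z) : Prop :=
  ps_cone p D lam l /\
  forall d'' (Y : measurableType d'') (q : probability Y R) (g : R.-pker Y ~> Z),
    ps_cone p D q g ->
    exists g' : R.-pker Y ~> L,
      [/\ ps_hom q lam g', as_eq q (pcomp l g') g &
          forall g'' : R.-pker Y ~> L,
            ps_hom q lam g'' -> as_eq q (pcomp l g'') g -> as_eq q g' g''].

End ps.

Definition ipower (X : Type) : Type := nat -> X.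

HB.instance Definition _ (X : choiceType) := Choice.on (ipower X).
HB.instance Definition _ (X : pointedType) := Pointed.on (ipower X).

Definition ipower_display : measure_display -> measure_display.
Proof. exact. Qed.

Section ipower_measurable.
Context d (X : measurableType d).

Definition ipower_measurable : set (set (ipower X)) :=
  <<s \bigcup_i preimage_set_system setT (fun x : ipower X => x i) measurable >>.

HB.instance Definition _ := @isMeasurable.Build (ipower_display d) (ipower X)
  ipower_measurable (@sigma_algebra0 _ _ _) (@sigma_algebraC _ _)
  (@sigma_algebra_bigcup _ _ _).

Lemma measurable_icoord i : measurable_fun setT (fun x : ipower X => x i).
Proof.
move=> _ B mB; apply: sub_sigma_algebra; exists i => //; by exists B.
Qed.

Lemma measurable_fun_ipower d' (T : measurableType d') (f : T -> ipower X) :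
  (forall i, measurable_fun setT (fun t => f t i)) -> measurable_fun setT f.
Proof.
move=> mf; apply: (@measurability _ _ _ _ _ _
  (\bigcup_i preimage_set_system setT (fun x : ipower X => x i) measurable)) => //.
move=> _ [_ [i _ [B mB <-] <-]].
by rewrite !setTI; have := mf i measurableT _ mB; rewrite setTI.
Qed.

End ipower_measurable.

(* The library's measures are functions on all sets, only constrained on the
   measurable ones; requiring them to vanish elsewhere gives each probability
   measure exactly one representative. *)
Record pspace d (X : measurableType d) (R : realType) := PSpace {
  pspace_prob :> probability X R ;
  pspace_out : forall A, ~ measurable A -> pspace_prob A = 0 }.

Section pspace_of.
Context d (X : measurableType d) (R : realType) (mu : probability X R).

Definition pcanon (A : set X) : \bar R :=
  if `[< measurable A >] then mu A else 0.

Lemma pcanonE A : measurable A -> pcanon A = mu A.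
Proof. by move=> mA; rewrite /pcanon asboolT. Qed.

Let pcanon0 : pcanon set0 = 0.
Proof. by rewrite pcanonE// measure0. Qed.

Let pcanon_ge0 A : 0 <= pcanon A.
Proof. by rewrite /pcanon; case: asboolP. Qed.

Let pcanon_sigma_additive : semi_sigma_additive pcanon.
Proof.
move=> F mF tF mUF; rewrite pcanonE//.
under eq_fun do under eq_bigr do rewrite pcanonE//.
exact: measure_semi_sigma_additive.
Qed.

HB.instance Definition _ := isMeasure.Build _ _ _ pcanon
  pcanon0 pcanon_ge0 pcanon_sigma_additive.

Let pcanonT : pcanon setT = 1.
Proof. by rewrite pcanonE// probability_setT. Qed.

HB.instance Definition _ := Measure_isProbability.Build _ _ _ pcanon pcanonT.

Let pcanon_out A : ~ measurable A -> (pcanon : probability X R) A = 0.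
Proof. by move=> mA; rewrite /= /pcanon asboolF. Qed.

Definition pspace_of : pspace X R := PSpace pcanon_out.

Lemma pspace_ofE A : measurable A -> pspace_of A = mu A.
Proof. exact: pcanonE. Qed.

End pspace_of.

HB.instance Definition _ d (X : measurableType d) (R : realType) :=
  gen_eqMixin (pspace X R).
HB.instance Definition _ d (X : measurableType d) (R : realType) :=
  gen_choiceMixin (pspace X R).
HB.instance Definition _ d (X : measurableType d) (R : realType) :=
  isPointed.Build (pspace X R) (pspace_of point).

Definition pspace_display : measure_display -> measure_display.
Proof. exact. Qed.

Section pspace_measurable.
Context d (X : measurableType d) (R : realType).

Lemma pspace_eq (q r : pspace X R) :
  (forall A, measurable A -> q A = r A) -> q = r.
Proof.
move=> qr; have : (q : set X -> \bar R) = r.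
  apply/funext => A; have [|nmA] := pselect (measurable A); first exact: qr.
  by rewrite !pspace_out.
case: q r {qr} => [[q [[a1 a2] [a3] [a4] [a5] [a6] [a7] [a8]]] q0].
case=> [[r [[b1 b2] [b3] [b4] [b5] [b6] [b7] [b8]]] r0] /= qr; subst r.
have [? ? ? ?] : [/\ a1 = b1, a2 = b2, a3 = b3 & a4 = b4].
  by split; exact: Prop_irrelevance.
have [? ? ? ?] : [/\ a5 = b5, a6 = b6, a7 = b7 & a8 = b8].
  by split; exact: Prop_irrelevance.
by subst b1 b2 b3 b4 b5 b6 b7 b8; congr PSpace; exact: Prop_irrelevance.
Qed.

Definition pspace_measurable : set (set (pspace X R)) :=
  <<s \bigcup_(A in @measurable _ X)
        preimage_set_system setT (fun q : pspace X R => q A)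
          measurable >>.

HB.instance Definition _ := @isMeasurable.Build (pspace_display d) (pspace X R)
  pspace_measurable (@sigma_algebra0 _ _ _) (@sigma_algebraC _ _)
  (@sigma_algebra_bigcup _ _ _).

Lemma measurable_pspace_ev (A : set X) : measurable A ->
  measurable_fun setT (fun q : pspace X R => q A).
Proof.
move=> mA _ B mB; apply: sub_sigma_algebra; exists A => //; by exists B.
Qed.

End pspace_measurable.

(* The infinite product measure is the Caratheodory extension of the content
   on the ring of measurable cylinders which integrates out the finitely many
   relevant coordinates one after the other. *)

Definition cyl_type (X : Type) : Type := nat -> X.

HB.instance Definition _ (X : pointedType) := Pointed.on (cyl_type X).

Definition cyl_display : measure_display -> measure_display.
Proof. exact. Qed.

Section cylinders.
Context d (X : measurableType d).

Definition depends (V : Type) (n : nat) (f : ipower X -> V) : Prop :=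
  forall x y, (forall i, (i < n)%N -> x i = y i) -> f x = f y.

Definition cylinder (A : set (ipower X)) : Prop :=
  measurable A /\ exists n, depends n A.

Lemma dependsW V m n (f : ipower X -> V) :
  (m <= n)%N -> depends m f -> depends n f.
Proof. by move=> mn df x y xy; apply: df => i im; exact/xy/(leq_trans im). Qed.

Let cylinder0 : cylinder set0.
Proof. by split => //; exists 0%N. Qed.

Let cylinderU : setU_closed cylinder.
Proof.
move=> A B [mA [m dA]] [mB [n dB]]; split; first exact: measurableU.
exists (maxn m n) => x y xy; rewrite /setU/=.
by rewrite (dependsW (leq_maxl _ _) dA xy) (dependsW (leq_maxr _ _) dB xy).
Qed.

Let cylinderD : setD_closed cylinder.
Proof.
move=> A B [mA [m dA]] [mB [n dB]]; split; first exact: measurableD.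
exists (maxn m n) => x y xy; rewrite /setD/=.
by rewrite (dependsW (leq_maxl _ _) dA xy) (dependsW (leq_maxr _ _) dB xy).
Qed.

HB.instance Definition _ := @isRingOfSets.Build (cyl_display d) (cyl_type X)
  cylinder cylinder0 cylinderU cylinderD.

Lemma cylinder_rect n (B : nat -> set X) : (forall i, measurable (B i)) ->
  cylinder [set x | forall i, (i < n)%N -> B i (x i)].
Proof.
move=> mB; split; last first.
  exists n => x y xy; apply/propext; split=> + i ni => /(_ i ni) /=;
  by rewrite xy.
rewrite (_ : mkset _ = \bigcap_(i in `I_n) ((fun x : ipower X => x i) @^-1` B i))//.
apply: bigcap_measurableType => i _.
by have := measurable_icoord i measurableT (mB i); rewrite setTI.
Qed.

Definition rects : set (set (ipower X)) :=
  [set A | exists n B, (forall i, measurable (B i)) /\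
                       A = [set x | forall i, (i < n)%N -> B i (x i)]].

Lemma rectsI : setI_closed rects.
Proof.
move=> _ _ [m [B [mB ->]]] [n [C [mC ->]]].
exists (maxn m n), (fun i => (if (i < m)%N then B i else setT) `&`
                             (if (i < n)%N then C i else setT)); split.
  by move=> i; apply: measurableI; case: ifP.
apply/seteqP; split => x /=.
  by move=> [Bx Cx] i _; split; case: ifP => // ii; [exact: Bx|exact: Cx].
move=> h; split => i ii.
  by have [] := h i (leq_trans ii (leq_maxl _ _)); rewrite ii.
by have [] := h i (leq_trans ii (leq_maxr _ _)); rewrite ii.
Qed.

Lemma rects_gen : (@measurable _ (ipower X)) = <<s rects >>.
Proof.
apply/seteqP; split.
  apply: smallest_sub; first exact: smallest_sigma_algebra.
  move=> _ [i _ [B mB <-]]; rewrite setTI; apply: sub_sigma_algebra.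
  exists i.+1, (fun j => if j == i then B else setT); split.
    by move=> j; case: ifP.
  apply/seteqP; split => x /=.
    by move=> Bx j _; case: eqP => // ->.
  by move=> /(_ i (ltnSn i)); rewrite eqxx.
apply: smallest_sub; first exact: sigma_algebra_measurable.
by move=> _ [n [B [mB ->]]]; have [] := @cylinder_rect n B mB.
Qed.

End cylinders.

Section product_content.
Context d (X : measurableType d) (R : realType).
Variable q : nat -> probability X R.
Local Notation XN := (ipower X).

Definition upd (x : XN) k (y : X) : XN := fun i => if i == k then y else x i.

Lemma measurable_upd k :
  measurable_fun setT (fun xy : XN * X => upd xy.1 k xy.2).
Proof.
apply: measurable_fun_ipower => i; rewrite /upd; case: (i == k).
  exact: measurable_snd.
by apply: (measurableT_comp (measurable_icoord i)); exact: measurable_fst.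
Qed.

(* integrating out the k-th coordinate *)
Definition cint k (f : XN -> \bar R) (x : XN) : \bar R :=
  \int[q k]_y f (upd x k y).

Lemma cint_ge0 k f : (forall x, 0 <= f x) -> forall x, 0 <= cint k f x.
Proof. by move=> f0 x; exact: integral_ge0. Qed.

Lemma measurable_upd1 k f x : measurable_fun setT f ->
  measurable_fun setT (fun y => f (upd x k y) : \bar R).
Proof.
move=> mf; apply: (measurableT_comp mf).
by apply: measurable_fun_ipower => i; rewrite /upd; case: (i == k).
Qed.

Lemma measurable_cint k f : measurable_fun setT f -> (forall x, 0 <= f x) ->
  measurable_fun setT (cint k f).
Proof.
move=> mf f0.
apply: (measurable_fun_fubini_tonelli_F (fun xy : XN * X => f (upd xy.1 k xy.2))).
  exact: (measurableT_comp mf (measurable_upd k)).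
by move=> xy.
Qed.

Lemma cint_depends k n f : depends n f -> depends n (cint k f).
Proof.
move=> df x y xy; apply: eq_integral => z _; apply: df => i ni.
by rewrite /upd; case: ifP => // _; exact: xy.
Qed.

Lemma cint_dependsS k f : depends k.+1 f -> depends k (cint k f).
Proof.
move=> df x y xy; apply: eq_integral => z _; apply: df => i ni.
by rewrite /upd; case: eqVneq => // ik; apply: xy; rewrite ltn_neqAle ik.
Qed.

Lemma cint_id k f : depends k f -> cint k f = f.
Proof.
move=> df; apply/funext => x; rewrite /cint.
under eq_integral => y _.
  rewrite (_ : f _ = f x); last first.
    by apply: df => i ik; rewrite /upd ltn_eqF.
  over.
by rewrite integral_cst//= probability_setT mule1.
Qed.

(* integrating out the coordinates n, ..., n + m - 1 *)
Fixpoint nint m n (f : XN -> \bar R) : XN -> \bar R :=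
  if m is m'.+1 then cint n (nint m' n.+1 f) else f.

Definition cdim (A : set XN) : nat := xget 0%N [set n | depends n A].

Lemma cdimP A : cylinder A -> depends (cdim A) A.
Proof.
by move=> [_ [n dA]]; rewrite /cdim; case: xgetP => [_ -> //|/(_ n)].
Qed.

Definition eindic (A : set XN) (x : XN) : \bar R := (\1_A x)%:E.

Lemma eindic_depends A n : depends n A -> depends n (eindic A).
Proof.
by move=> dA x y xy; rewrite /eindic !indicE /in_mem /= /in_set/= (dA _ _ xy).
Qed.

Lemma eindic_ge0 A x : 0 <= eindic A x.
Proof. by rewrite lee_fin. Qed.

Lemma measurable_eindic A : measurable A -> measurable_fun setT (eindic A).
Proof. by move=> mA; apply/measurable_EFinP; exact: measurable_indic. Qed.

Definition tail_int A n : XN -> \bar R := nint (cdim A - n) n (eindic A).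

Lemma nint_ge0 m n f : (forall x, 0 <= f x) -> forall x, 0 <= nint m n f x.
Proof. by move=> f0; elim: m n => [//|m ih] n /=; apply: cint_ge0; exact: ih. Qed.

Lemma measurable_nint m n f : measurable_fun setT f -> (forall x, 0 <= f x) ->
  measurable_fun setT (nint m n f).
Proof.
move=> mf f0; elim: m n => [//|m ih] n /=.
by apply: measurable_cint; [exact: ih|exact: nint_ge0].
Qed.

Lemma nint_depends m n f : depends (n + m) f -> depends n (nint m n f).
Proof.
elim: m n => [|m ih] n /=; first by rewrite addn0.
by rewrite addnS -addSn => df; apply: cint_dependsS; exact: ih.
Qed.

Lemma tail_int_ge0 A n x : 0 <= tail_int A n x.
Proof. by apply: nint_ge0 => y; exact: eindic_ge0. Qed.

Lemma measurable_tail_int A n : measurable A ->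
  measurable_fun setT (tail_int A n).
Proof.
by move=> mA; apply: measurable_nint;
  [exact: measurable_eindic|exact: eindic_ge0].
Qed.

Lemma tail_int_end A n : (cdim A <= n)%N -> tail_int A n = eindic A.
Proof. by rewrite /tail_int -subn_eq0 => /eqP ->. Qed.

Lemma tail_intS A n : cylinder A -> tail_int A n = cint n (tail_int A n.+1).
Proof.
move=> cA; have [An|nA] := leqP (cdim A) n.
  rewrite !tail_int_end//; last exact: leqW.
  rewrite cint_id//; apply: eindic_depends; exact: dependsW (cdimP cA).
by rewrite {1}/tail_int -(subnSK nA).
Qed.

Lemma tail_int_depends A n : cylinder A -> depends n (tail_int A n).
Proof.
move=> cA; apply: nint_depends; apply: eindic_depends.
by apply: dependsW (cdimP cA); rewrite -leq_subLR.
Qed.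

Lemma nat_down (P : nat -> Prop) N :
  (forall n, (N <= n)%N -> P n) -> (forall n, P n.+1 -> P n) -> forall n, P n.
Proof.
move=> PN PS n; have : P (n + N)%N by apply: PN; rewrite leq_addl.
elim: N {PN} => [|N ih]; first by rewrite addn0.
by rewrite addnS => /PS.
Qed.

Lemma tail_intU A B n : cylinder A -> cylinder B -> A `&` B = set0 ->
  forall x, tail_int (A `|` B) n x = tail_int A n x + tail_int B n x.
Proof.
move=> cA cB AB.
have cAB : cylinder (A `|` B).
  exact: (@measurableU _ (cyl_type X) A B cA cB).
have [mA _] := cA; have [mB _] := cB.
move: n; apply: (nat_down (N := maxn (cdim (A `|` B)) (maxn (cdim A) (cdim B)))).
  move=> n; rewrite !geq_max => /and3P[nAB nA nB] x.
  rewrite !tail_int_end// /eindic !indicE in_setU -EFinD; congr EFin.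
  have [xA|xA] := boolP (x \in A); last by rewrite add0r.
  have [xB|xB] := boolP (x \in B); last by rewrite addr0.
  have : (A `&` B) x by split; exact: set_mem.
  by rewrite AB.
move=> n ih x; rewrite (tail_intS n cAB) (tail_intS n cA) (tail_intS n cB) /cint.
under eq_integral do rewrite ih.
rewrite ge0_integralD//.
- by move=> y _; exact: tail_int_ge0.
- by apply: measurable_upd1; exact: measurable_tail_int.
- by move=> y _; exact: tail_int_ge0.
- by apply: measurable_upd1; exact: measurable_tail_int.
Qed.

Definition cyl_content (A : set (cyl_type X)) : \bar R := tail_int A 0 point.

Let cyl_content_ge0 A : 0 <= cyl_content A.
Proof. exact: tail_int_ge0. Qed.

Lemma tail_int0 n x : tail_int set0 n x = 0.
Proof.
have c0 := @measurable0 _ (cyl_type X).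
move: n x; apply: (nat_down (N := cdim set0)).
  by move=> n n0 x; rewrite tail_int_end// /eindic indic0.
move=> n ih x; rewrite (tail_intS n c0) /cint.
under eq_integral do rewrite ih.
by rewrite integral0.
Qed.

Let cyl_content0 : cyl_content set0 = 0.
Proof. exact: tail_int0. Qed.

Let cyl_content_additive : measure_function.semi_additive cyl_content.
Proof.
apply/(additive2P cyl_content0) => A B mA mB AB.
exact: tail_intU.
Qed.

HB.instance Definition _ := isContent.Build _ (cyl_type X) R cyl_content
  cyl_content_ge0 cyl_content_additive.

Lemma cyl_content_sigma_subadditive :
  measurable_subset_sigma_subadditive cyl_content.
Proof.
move=> A F mF mA AF; rewrite leNgt; apply/negP => lt0.
pose bad n x := \sum_(k <oo) tail_int (F k) n x < tail_int A n x.
have step n x : bad n x -> exists y, bad n.+1 (upd x n y).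
  move=> bx; apply: contrapT => /forallNP nb; move: bx; rewrite /bad ltNge.
  apply/negP/negPn; rewrite (tail_intS n mA).
  under eq_eseriesr => k _ do rewrite (tail_intS n (mF k)).
  rewrite /cint -integral_nneseries//; last 2 first.
  - by move=> k; apply: measurable_upd1; apply: measurable_tail_int; have [] := mF k.
  - by move=> k y _; exact: tail_int_ge0.
  apply: ge0_le_integral => //.
  - by move=> y _; exact: tail_int_ge0.
  - by apply: measurable_upd1; apply: measurable_tail_int; have [] := mA.
  - apply: ge0_emeasurable_sum => k; first by move=> y _ _; exact: tail_int_ge0.
    by move=> _; apply: measurable_upd1; apply: measurable_tail_int; have [] := mF k.
  - by move=> y _; rewrite leNgt; apply/negP; exact: nb.
have [g gP] : {g : nat -> XN -> X & forall n x, bad n x -> bad n.+1 (upd x n (g n x))}.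
  have [g gP] := choice (fun nx : nat * XN =>
    match pselect (bad nx.1 nx.2) with
    | left h => let: ex_intro y yP := step _ _ h in
        ex_intro (fun y => bad nx.1 nx.2 -> bad nx.1.+1 (upd nx.2 nx.1 y)) y (fun=> yP)
    | right h => ex_intro _ point (fun h' => False_ind _ (h h'))
    end).
  by exists (fun n x => g (n, x)) => n x; exact: (gP (n, x)).
pose xs := fix xs n := if n is n'.+1 then upd (xs n') n' (g n' (xs n')) else point.
have xs_bad n : bad n (xs n) by elim: n => [//|n ih] /=; exact: gP.
pose x : XN := fun i => xs i.+1 i.
have xs_x n i : (i < n)%N -> xs n i = x i.
  elim: n => [//|n ih]; rewrite ltnS leq_eqVlt => /orP[/eqP -> //|ni].
  by rewrite /= /upd ltn_eqF// ih.
have bad_x n : bad n x.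
  have := xs_bad n; rewrite /bad (tail_int_depends mA (xs_x n)).
  by under eq_eseriesr => k _ do rewrite (tail_int_depends (mF k) (xs_x n)).
have [Ax|nAx] := pselect (A x); last first.
  have := bad_x (cdim A); rewrite /bad tail_int_end// /eindic indicE memNset//.
  by rewrite ltNge nneseries_ge0// => k _ _; exact: tail_int_ge0.
have [k _ Fkx] := AF x Ax.
have := bad_x (maxn (cdim A) (cdim (F k))).
rewrite /bad ltNge => /negP; apply.
rewrite (tail_int_end (leq_maxl _ _)).
apply: (@le_trans _ _ (tail_int (F k) (maxn (cdim A) (cdim (F k))) x)).
  by rewrite (tail_int_end (leq_maxr _ _)) /eindic !indicE !mem_set.
rewrite (nneseriesD1 (n := k))//; last by move=> ? _; exact: tail_int_ge0.
by rewrite leeDl// nneseries_ge0// => ? _ _; exact: tail_int_ge0.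
Qed.

HB.instance Definition _ := Content_SigmaSubAdditive_isMeasure.Build _ R
  (cyl_type X) cyl_content cyl_content_sigma_subadditive.

Definition prod_ext : set XN -> \bar R := measure_extension cyl_content.

Let ipower_sub : (@measurable _ XN) `<=`
  (@measurable _ (cyl_type X)).-sigma.-measurable.
Proof.
rewrite rects_gen; apply: smallest_sub; first exact: smallest_sigma_algebra.
move=> _ [n [B [mB ->]]]; apply: sub_sigma_algebra; exact: cylinder_rect.
Qed.

Let prod_ext0 : prod_ext set0 = 0.
Proof. exact: (measure0 (measure_extension cyl_content)). Qed.

Let prod_ext_ge0 A : 0 <= prod_ext A.
Proof. exact: (measure_ge0 (measure_extension cyl_content)). Qed.

Let prod_ext_sigma_additive : semi_sigma_additive prod_ext.
Proof.
move=> F mF tF mUF.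
apply: (@measure_semi_sigma_additive _ _ _ (measure_extension cyl_content)) => //.
  by move=> i; exact: ipower_sub.
exact: ipower_sub.
Qed.

HB.instance Definition _ := isMeasure.Build _ XN R prod_ext
  prod_ext0 prod_ext_ge0 prod_ext_sigma_additive.

Lemma prod_extE A : cylinder A -> prod_ext A = tail_int A 0 point.
Proof. by move=> cA; rewrite /prod_ext /measure_extension measurable_mu_extE. Qed.

Lemma prod_ext_rect n (B : nat -> set X) : (forall i, measurable (B i)) ->
  prod_ext [set x | forall i, (i < n)%N -> B i (x i)] =
  \prod_(i < n) q i (B i).
Proof.
move=> mB; rewrite prod_extE; last exact: cylinder_rect.
pose rect m : set XN := [set x | forall i, (i < m)%N -> B i (x i)].
have cr m : cylinder (rect m) by exact: cylinder_rect.
rewrite -[mkset _]/(rect n).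
suff h k x : tail_int (rect n) k x =
    eindic (rect (minn k n)) x * \prod_(k <= i < n) q i (B i).
  by rewrite h min0n big_mkord /eindic indicE mem_set// mul1e.
move: k x; apply: (nat_down (N := maxn n (cdim (rect n)))).
  move=> k; rewrite geq_max => /andP[nk rk] x.
  by rewrite tail_int_end// (minn_idPr nk) big_geq// mule1.
move=> k ih x; rewrite (tail_intS k (cr n)) /cint.
under eq_integral do rewrite ih.
have [nk|kn] := leqP n k.
  rewrite (minn_idPr (leqW nk)) !big_geq//; last exact: leqW.
  under eq_integral do rewrite mule1.
  rewrite mule1 -/(cint k (eindic (rect n)) x) cint_id//.
  apply: eindic_depends; apply: (dependsW nk).
  move=> y z yz; apply/propext; split=> + i ni => /(_ i ni) /=; by rewrite yz.
rewrite (minn_idPl kn) [\prod_(k <= i < n) _]big_ltn//.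
have p0 : 0 <= \prod_(k.+1 <= i < n) q i (B i).
  by apply: prode_ge0 => i _; exact: measure_ge0.
have mr : measurable_fun setT (fun y => eindic (rect k.+1) (upd x k y)).
  by apply: measurable_upd1; apply: measurable_eindic; have [] := cr k.+1.
rewrite ge0_integralZr//; last by move=> y _; exact: eindic_ge0.
rewrite muleA; congr (_ * _).
transitivity (\int[q k]_y (eindic (rect k) x * (\1_(B k) y)%:E)).
  apply: eq_integral => y _; rewrite /eindic -EFinM !indicE -natrM mulnb.
  congr (_%:R%:E); congr nat_of_bool; apply/idP/andP.
    move=> /set_mem h; split; apply: mem_set.
      by move=> i ik; have := h i (leqW ik); rewrite /upd ltn_eqF.
    by have := h k (ltnSn k); rewrite /upd eqxx.
  move=> [/set_mem h /set_mem Bky]; apply: mem_set => i.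
  rewrite ltnS leq_eqVlt /upd => /orP[/eqP ->|ik]; first by rewrite eqxx.
  by rewrite ltn_eqF//; exact: h.
have mB' : measurable_fun setT (fun y => (\1_(B k) y)%:E : \bar R).
  by apply/measurable_EFinP; exact: measurable_indic.
rewrite ge0_integralZl//; [|exact: eindic_ge0].
by rewrite integral_indic// setIT.
Qed.

Let prod_extT : prod_ext setT = 1.
Proof.
have := @prod_ext_rect 0 (fun=> setT) (fun=> measurableT).
rewrite big_ord0 => <-; congr prod_ext.
by apply/seteqP; split.
Qed.

HB.instance Definition _ := Measure_isProbability.Build _ XN R prod_ext prod_extT.

Lemma ex_infinite_product : exists P : probability XN R,
  forall n (B : nat -> set X), (forall i, measurable (B i)) ->
    P [set x | forall i, (i < n)%N -> B i (x i)] = \prod_(i < n) q i (B i).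
Proof. by exists prod_ext => n B mB; exact: prod_ext_rect. Qed.

End product_content.

Section infinite_product.
Context d (X : measurableType d) (R : realType).

(* The product measure of the q i; its values on the measurable rectangles
   determine it on all measurable sets. *)
Definition infinite_product (q : nat -> probability X R) :
  probability (ipower X) R := sval (cid (ex_infinite_product q)).

Lemma infinite_productE (q : nat -> probability X R) n (B : nat -> set X) :
  (forall i, measurable (B i)) ->
  infinite_product q [set x | forall i, (i < n)%N -> B i (x i)] =
  \prod_(i < n) q i (B i).
Proof. by move=> mB; rewrite /infinite_product; case: cid => P /= ->. Qed.

Lemma infinite_product_unique (q : nat -> probability X R)
    (P : probability (ipower X) R) :
  (forall n (B : nat -> set X), (forall i, measurable (B i)) ->
    P [set x | forall i, (i < n)%N -> B i (x i)] = \prod_(i < n) q i (B i)) ->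
  forall A, measurable A -> P A = infinite_product q A.
Proof.
move=> hP A mA; apply: (@measure_unique _ _ _ (@rects _ X) (fun=> setT)).
- exact: rects_gen.
- exact: rectsI.
- move=> _; exists 0%N, (fun=> setT); split => //.
  by apply/seteqP; split.
- by rewrite bigcup_const.
- move=> _ [n [B [mB ->]]]; exact: etrans (hP n B mB) (esym (infinite_productE q n mB)).
- by move=> _; rewrite /= probability_setT ltry.
- exact: mA.
Qed.

Local Notation PX := (pspace X R).

Definition samp (q : ipower PX) : {measure set (ipower X) -> \bar R} :=
  infinite_product (fun i => q i).

Let measurable_samp A : measurable A -> measurable_fun setT (samp ^~ A).
Proof.
pose H : set (set (ipower X)) :=
  [set A | measurable A /\ measurable_fun setT (samp ^~ A)].
suff : (@measurable _ (ipower X)) `<=` H by move=> h /h[].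
rewrite rects_gen; apply: lambda_system_subset => //.
- exact: rectsI.
- split => //.
  + by split => //; rewrite (_ : samp ^~ _ = cst 1)//; apply/funext => q;
      exact: probability_setT.
  + move=> B C CB [mB mfB] [mC mfC]; split; first exact: measurableD.
    rewrite (_ : samp ^~ _ = (fun q => samp q B - samp q C)).
      exact: emeasurable_funB.
    apply/funext => q; rewrite measureD ?setIidr//.
    by rewrite -ge0_fin_numE ?fin_num_measure//.
  + move=> F ndF HF; have mF i : measurable (F i) by have [] := HF i.
    split; first exact: bigcup_measurable.
    apply: (emeasurable_fun_cvg (fun i q => samp q (F i))).
      by move=> i; have [] := HF i.
    move=> q _; apply: nondecreasing_cvg_mu => //; exact: bigcup_measurable.
- move=> _ [n [B [mB ->]]]; split; first by have [] := cylinder_rect n mB.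
  rewrite (_ : samp ^~ _ = (fun q : ipower PX => \prod_(i < n) q i (B i))).
    2: by apply/funext => q; exact: infinite_productE.
  elim: n => [|n ih]; first by under eq_fun do rewrite big_ord0; exact: measurable_cst.
  under eq_fun do rewrite big_ord_recr/=.
  apply: emeasurable_funM => //.
  exact: (@measurableT_comp _ _ _ _ _ _ (fun r : PX => r (B n)) _
    (fun q : ipower PX => q n) (measurable_pspace_ev (mB n))
    (@measurable_icoord _ PX n)).
Qed.

HB.instance Definition _ := isKernel.Build _ _ _ _ _ samp measurable_samp.

Let samp_prob q : samp q setT = 1.
Proof. exact: probability_setT. Qed.

HB.instance Definition _ := Kernel_isProbability.Build _ _ _ _ _ samp samp_prob.

Definition diag (T : Type) (t : T) : ipower T := fun=> t.

Lemma measurable_diag d' (T : measurableType d') : measurable_fun setT (@diag T).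
Proof. by apply: measurable_fun_ipower => i; exact: measurable_id. Qed.

Definition copyN : R.-pker PX ~> ipower PX := kdirac (@measurable_diag _ PX).

Definition iid : R.-pker PX ~> ipower X := pcomp samp copyN.

Lemma iidE r A : measurable A -> iid r A = infinite_product (fun=> r) A.
Proof.
move=> mA; rewrite [LHS]pcompE integral_dirac//.
  by rewrite diracT mul1e.
exact: (measurable_kernel samp).
Qed.

End infinite_product.
Arguments samp {d X R}.
Arguments copyN {d X R}.
Arguments iid {d X R}.

Record finperm := FinPerm {
  fperm :> nat -> nat ;
  fperm_bij : bijective fperm ;
  fperm_fin : finite_set [set n | fperm n != n] }.

Lemma finperm_eq (s t : finperm) : (fperm s =1 fperm t) -> s = t.
Proof.
case: s t => [s bs fs] [t bt ft] /= /funext st; subst t.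
by congr FinPerm; exact: Prop_irrelevance.
Qed.

HB.instance Definition _ := gen_eqMixin finperm.
HB.instance Definition _ := gen_choiceMixin finperm.

Section finperm_group.

Definition finperm_one : finperm.
Proof.
exists id; first by exists id.
by rewrite (_ : mkset _ = set0)//; apply/seteqP; split=> n //=; rewrite eqxx.
Defined.

Definition finperm_mul (s t : finperm) : finperm.
Proof.
exists (s \o t); first by apply: bij_comp; exact: fperm_bij.
apply: (@sub_finite_set _ _ ([set n | t n != n] `|` [set n | s n != n])).
  move=> n /= stn; have [tn|] := eqVneq (t n) n; last by left.
  by right; rewrite -{1}tn.
by rewrite finite_setU; split; exact: fperm_fin.
Defined.

Lemma finperm_inv_ex (s : finperm) : exists t : finperm, cancel s t /\ cancel t s.
Proof.
have [t st ts] := fperm_bij s.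
have ft : finite_set [set n | t n != n].
  apply: sub_finite_set (fperm_fin s) => n /=; apply: contra_neq => sn.
  by rewrite -{1}sn st.
by exists (@FinPerm t (Bijective ts st) ft).
Qed.

Definition finperm_inv (s : finperm) : finperm := sval (cid (finperm_inv_ex s)).

Lemma finperm_invP (s : finperm) : cancel s (finperm_inv s) /\ cancel (finperm_inv s) s.
Proof. by rewrite /finperm_inv; case: cid. Qed.

Let mulA : associative finperm_mul.
Proof. by move=> s t u; exact: finperm_eq. Qed.
Let mul1 : left_id finperm_one finperm_mul.
Proof. by move=> s; exact: finperm_eq. Qed.
Let mulr1' : right_id finperm_one finperm_mul.
Proof. by move=> s; exact: finperm_eq. Qed.
Let mulV : left_inverse finperm_one finperm_inv finperm_mul.
Proof. by move=> s; apply: finperm_eq => n /=; have [+ _] := finperm_invP s; exact. Qed.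
Let mulV' : right_inverse finperm_one finperm_inv finperm_mul.
Proof. by move=> s; apply: finperm_eq => n /=; have [_ +] := finperm_invP s; exact. Qed.

HB.instance Definition _ := isGroup.Build finperm mulA mul1 mulr1' mulV mulV'.

End finperm_group.

Section permutation_action.
Context d (X : measurableType d) (R : realType).

(* left action: the component at place i moves to place s i *)
Definition permute (s : finperm) (x : ipower X) : ipower X :=
  fun i => x ((s^-1)%g i).

Lemma measurable_permute s : measurable_fun setT (permute s).
Proof. by apply: measurable_fun_ipower => i; exact: measurable_icoord. Qed.

Definition perm_action (s : finperm) : R.-pker ipower X ~> ipower X :=
  kdirac (measurable_permute s).

Definition exchangeable (p : probability (ipower X) R) : Prop :=
  forall (s : finperm) B, measurable B -> p (permute s @^-1` B) = p B.

Lemma exchangeableP (p : probability (ipower X) R) :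
  exchangeable p <-> forall s, ps_hom p p (perm_action s).
Proof.
suff h s B : measurable B -> kapp (perm_action s) p B = p (permute s @^-1` B).
  by split=> ep s B mB; [rewrite h// ep|rewrite -h// ep].
move=> mB; have mB' : measurable (permute s @^-1` B).
  by have := measurable_permute s measurableT mB; rewrite setTI.
transitivity (\int[p]_x (\1_(permute s @^-1` B) x)%:E) => //.
by rewrite integral_indic// setIT.
Qed.

Lemma perm_action1 x B : perm_action 1%g x B = kid x B.
Proof.
have e : permute 1%g x = x by apply/funext => i; rewrite /permute invg1.
by rewrite -[LHS]/(\d_(permute 1%g x) B) e.
Qed.

Lemma perm_actionM s t x B : measurable B ->
  perm_action (s * t)%g x B = pcomp (perm_action s) (perm_action t) x B.
Proof.
move=> mB; rewrite pcompE integral_dirac//; last first.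
  exact: (measurable_kernel (perm_action s) B mB).
have e : permute (s * t)%g x = permute s (permute t x).
  by apply/funext => i; rewrite /permute invgM.
by rewrite diracT mul1e -[LHS]/(\d_(permute (s * t)%g x) B) e.
Qed.

End permutation_action.
Arguments perm_action {d} X R s.

(* Main.v *)
(* De Finetti's theorem in functional form. For an exchangeable sequence x the
   frequency of a set A among the first n terms converges in L2, since
   E (freq_n A - freq_m A)^2 = const * (1/n - 1/m) for n <= m. When X is the
   Cantor space, the limits over the cylinders A assemble almost surely into a
   probability measure F x, and F : X^N -> PX is measurable. By exchangeability
   p (A_1 x ... x A_k x X^N) = E (F x A_1 * ... * F x A_k), that is,
   iid o F o p = p for exchangeable p; the cases k = 1, 2 for a product measure
   give that F is almost surely constant, that is, F o iid = id on PX. Both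
   properties pass to every measurable retract of the Cantor space, and every
   standard Borel space is one. They formally imply the theorem: mu is F o p,
   and a cone g factors as iid o (F o g), where invariance is used after
   conditioning on each event of the source of g.

   PX is standard Borel since it is a retract of a countable power of R, by
   means of its values on cylinders; conversely a retract of the Baire space is
   isomorphic to a Borel subset of it, so to a closed one, which is Polish. *)

Require Import Defs.
From HB Require Import structures.
From mathcomp Require Import all_boot all_order all_algebra.
From mathcomp Require Import all_classical all_reals all_analysis.
From mathcomp Require Import measurable_realfun.
From mathcomp Require Import ring lra.

Set Implicit Arguments.
Unset Strict Implicit.
Unset Printing Implicit Defensive.
Import Order.TTheory GRing.Theory Num.Theory.
Import numFieldNormedType.Exports.

Local Open Scope classical_set_scope.
Local Open Scope ring_scope.
Local Open Scope ereal_scope.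

(** * Measurable retracts *)

(** Retracts replace isomorphisms throughout: a section-retraction pair is enough to carry spaces of
    measures and infinite products along, so no Borel isomorphism theorem is needed. The Cantor
    space is chosen because a law on it is determined by its masses on countably many cylinders.
    Only countably many almost sure statements are then needed, and the only condition on the masses
    is finite additivity. No extension theorem is used to build the law: a uniform point of the unit
    interval is decoded into a branch, and measurability in the masses follows from joint
    measurability of the decoding.

    The map [F] is everywhere defined and is fixed before any law is given; it serves every
    exchangeable [p] and every cone at once. This gives both uniqueness claims: applying [F] to
    [iid] returns the point, so whatever is mapped by [iid] to a given law is recovered from that
    law through [F].

    Convergence of frequencies is proved along the powers of 4, where the mean increments decrease
    geometrically; this makes them summable and is enough to identify the limit. *)

Section measurable_sets.
Context d (T : measurableType d).

Lemma mset_cst (Q : Prop) : measurable [set t : T | Q].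
Proof.
have [q|q] := pselect Q.
  by rewrite (_ : mkset _ = setT)//; apply/seteqP; split.
by rewrite (_ : mkset _ = set0)//; apply/seteqP; split.
Qed.

Lemma mset_ex (I : countType) (P : I -> T -> Prop) :
  (forall i, measurable [set t | P i t]) ->
  measurable [set t | exists i, P i t].
Proof.
move=> mP; rewrite (_ : mkset _ = \bigcup_i [set t | P i t]).
  exact: (countable_bigcupT_measurable (countableP _)).
by apply/seteqP; split => t /= [i]; [exists i|move=> _ ?; exists i].
Qed.

Lemma mset_not (P : T -> Prop) :
  measurable [set t | P t] -> measurable [set t | ~ P t].
Proof. exact: measurableC. Qed.

Lemma mset_and (P Q : T -> Prop) : measurable [set t | P t] ->
  measurable [set t | Q t] -> measurable [set t | P t /\ Q t].
Proof. exact: measurableI. Qed.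

Lemma mset_or (P Q : T -> Prop) : measurable [set t | P t] ->
  measurable [set t | Q t] -> measurable [set t | P t \/ Q t].
Proof. exact: measurableU. Qed.

Lemma mset_all (I : countType) (P : I -> T -> Prop) :
  (forall i, measurable [set t | P i t]) ->
  measurable [set t | forall i, P i t].
Proof.
move=> mP; rewrite (_ : mkset _ = ~` [set t | exists i, ~ P i t]).
  by apply: measurableC; apply: mset_ex => i; exact: mset_not.
by apply/seteqP; split => t /=; rewrite existsNE notK.
Qed.

Lemma mset_count (I : countType) (f : T -> I) (Q : I -> Prop) :
  (forall i, measurable [set t | f t = i]) -> measurable [set t | Q (f t)].
Proof.
move=> mf; rewrite (_ : mkset _ = [set t | exists i, f t = i /\ Q i]).
  by apply: mset_ex => i; apply: mset_and => //; exact: mset_cst.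
by apply/seteqP; split => t /=; [exists (f t)|move=> [i [->]]].
Qed.

Lemma mset_preimage d' (U : measurableType d') (f : T -> U) (B : set U) :
  measurable_fun setT f -> measurable B -> measurable [set t | B (f t)].
Proof. by move=> mf mB; have := mf measurableT B mB; rewrite setTI. Qed.

Lemma measurable_fun_nat (f : T -> nat) :
  (forall i, measurable [set t | f t = i]) -> measurable_fun setT f.
Proof. by move=> mf _ B _; rewrite setTI; exact: (@mset_count _ f B). Qed.

Lemma measurable_fun_boolP (f : T -> bool) :
  measurable [set t | f t] -> measurable_fun setT f.
Proof.
move=> mf _ B _; rewrite setTI; apply: (@mset_count _ f B) => -[].
  exact: mf.
rewrite (_ : mkset _ = [set t | ~ f t]); first exact: mset_not.
by apply/seteqP; split => t /=; case: (f t).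
Qed.

End measurable_sets.

Lemma measurable_fun_pspace d d' (T : measurableType d) (X : measurableType d')
    (R : realType) (f : T -> pspace X R) :
  (forall A, measurable A -> measurable_fun setT (fun t => f t A)) ->
  measurable_fun setT f.
Proof.
move=> mf; apply: (@measurability _ _ _ _ _ _ (\bigcup_(A in @measurable _ X)
  preimage_set_system setT (fun q : pspace X R => q A) measurable)) => //.
move=> _ [_ [A mA [B mB <-] <-]].
by rewrite !setTI; have := mf A mA measurableT _ mB; rewrite setTI.
Qed.

Section least.

Definition least (P : nat -> bool) : nat :=
  if pselect (exists i, P i) is left e then ex_minn e else 0%N.

Lemma leastP (P : nat -> bool) i : P i -> P (least P).
Proof.
by move=> Pi; rewrite /least; case: pselect => [e|[]];
  [case: ex_minnP|exists i].
Qed.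

Lemma least_eq (P : nat -> bool) i :
  least P = i <->
  (P i /\ forall j : 'I_i, ~ P j) \/ (i = 0%N /\ forall j, ~ P j).
Proof.
rewrite /least; case: pselect => [e|ne]; last first.
  split=> [<-|]; first by right; split=> // j Pj; apply: ne; exists j.
  by move=> [[Pi _]|[->]//]; case: ne; exists i.
case: ex_minnP => m Pm mP; split=> [<-|[[Pi ji]|[_ nP]]]; last by have := nP m.
  left; split=> // j Pj.
  by have := mP j Pj; rewrite leqNgt ltn_ord.
apply/eqP; rewrite eqn_leq mP// leqNgt; apply/negP => mi.
exact: (ji (Ordinal mi)).
Qed.

Lemma measurable_least d (T : measurableType d) (P : T -> nat -> bool) :
  (forall i, measurable [set t | P t i]) ->
  measurable_fun setT (fun t => least (P t)).
Proof.
move=> mP; apply: measurable_fun_nat => i.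
rewrite (_ : mkset _ = [set t | (P t i /\ forall j : 'I_i, ~ P t j) \/
                                (i = 0%N /\ forall j, ~ P t j)]).
  apply: mset_or; apply: mset_and; [exact: mP| |exact: mset_cst|];
    by apply: mset_all => j; exact: mset_not.
by apply/seteqP; split => t /= /least_eq.
Qed.

End least.

Section retract.

Definition mretract d d' (X : measurableType d) (Y : measurableType d') :
  Prop :=
  exists (c : X -> Y) (l : Y -> X),
    [/\ measurable_fun setT c, measurable_fun setT l & cancel c l].

Lemma mretract_trans d d' d'' (X : measurableType d) (Y : measurableType d')
    (Z : measurableType d'') : mretract X Y -> mretract Y Z -> mretract X Z.
Proof.
move=> [c [l [mc ml cl]]] [c' [l' [mc' ml' cl']]].
exists (c' \o c), (l \o l'); split; try exact: measurableT_comp.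
exact: can_comp.
Qed.

Lemma mretract_ipower d d' (X : measurableType d) (Y : measurableType d') :
  mretract X Y -> mretract (ipower X) (ipower Y).
Proof.
move=> [c [l [mc ml cl]]]; exists (fun x i => c (x i)), (fun y i => l (y i));
  split.
- apply: measurable_fun_ipower => i; apply: (measurableT_comp mc).
  exact: measurable_icoord.
- apply: measurable_fun_ipower => i; apply: (measurableT_comp ml).
  exact: measurable_icoord.
- by move=> x; apply/funext => i; exact: cl.
Qed.

Lemma mretract_ipower2 d (X : measurableType d) :
  mretract (ipower (ipower X)) (ipower X).
Proof.
exists (fun x n => if unpickle n is Some ij then x ij.1 ij.2 else point),
  (fun y i j => y (pickle (i, j))); split.
- apply: measurable_fun_ipower => n; case: (unpickle n) => [[i j]|//] /=.
  exact: (measurableT_comp (measurable_icoord j) (measurable_icoord i)).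
- apply: measurable_fun_ipower => i; apply: measurable_fun_ipower => j.
  exact: measurable_icoord.
- by move=> x; apply/funext => i; apply/funext => j; rewrite pickleK.
Qed.

(** A sequence of naturals is coded by the characteristic function of its graph. Decoding searches
    for the least value marked in each row, with default 0 on rows that are empty, so it is total
    and measurable. *)
Lemma mretract_nat_bool : mretract (ipower nat) (ipower bool).
Proof.
exists (fun z n => if unpickle n is Some ij then z ij.1 == ij.2 else false),
  (fun b i => least (fun j => b (pickle (i, j)))); split.
- apply: measurable_fun_ipower => n; case: (unpickle n) => [[i j]|//] /=.
  apply: measurable_fun_boolP => /=.
  apply: (@mset_preimage _ _ _ _ (fun z : ipower nat =>
    z i) [set k | k == j]) => //.
  exact: measurable_icoord.
- apply: measurable_fun_ipower => i; apply: measurable_least => j.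
  apply: (@mset_preimage _ _ _ _ (fun z : ipower bool => z (pickle (i, j)))
     [set b | b]) => //.
  exact: measurable_icoord.
- move=> z; apply/funext => i.
  set P := (X in least X).
  have : P (least P) by apply: (@leastP P (z i)); rewrite /P pickleK.
  by rewrite {1}/P pickleK => /eqP.
Qed.

End retract.

(** * Standard Borel spaces are the measurable retracts of the Baire space *)

Section polish_limit.
Context (R : realType) (S : completePseudoMetricType R) (u : nat -> S).

Local Notation lim_at z := (lim (u (z k) @[k --> \oo])).

(** The radii are restricted to inverses of naturals, so that the set of convergent sequences
    becomes a countable combination of conditions on two terms each. *)
Lemma seq_cauchyP (v : nat -> S) : cvg (v k @[k --> \oo]) <->
  forall e : nat, exists N : nat, forall k l : nat,
    (N <= k)%N -> (N <= l)%N -> ball (v k) (e.+1%:R^-1 : R) (v l).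
Proof.
split=> [cv e|cv].
  have e0 : (0 < (e.+1%:R^-1 : R) / 2)%R by rewrite divr_gt0// invr_gt0.
  have [N _ vN] := (@cvg_ballP _ _ _ _ _ _ _).1 cv _ e0.
  exists N => k l Nk Nl; apply: (ball_splitr (z := lim (v k @[k --> \oo]))).
    exact: vN.
  exact: vN.
apply: cauchy_cvg; apply: cauchy_exP => e e0.
have [n ne] : exists n : nat, (n.+1%:R^-1 <= e)%R.
  exists (Num.truncn e^-1); rewrite invf_ple ?posrE//.
  by apply/ltW; rewrite truncnS_gt.
have [N vN] := cv n; exists (v N); exists N => // k /= Nk.
by apply: le_ball (vN N k (leqnn N) Nk).
Qed.

(** The right-hand side does not mention the limit and quantifies over naturals only; this is what
    makes taking limits measurable. The radius is fixed before the index, so that the ball around a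
    late term still reaches the limit. *)
Lemma open_limP (v : nat -> S) (x : S) (U : set S) : open U ->
  v k @[k --> \oo] --> x ->
  U x <-> exists e N : nat, forall k : nat, (N <= k)%N ->
    ball (v k) (e.+1%:R^-1 : R) `<=` U.
Proof.
move=> oU vx; split=> [Ux|[e [N vN]]]; last first.
  have e0 : (0 < (e.+1%:R^-1 : R))%R by rewrite invr_gt0.
  have [M _ vM] := (@cvg_ballP _ _ _ _ _ _ _).1 vx _ e0.
  apply: (vN (maxn N M) (leq_maxl _ _)); apply: ball_sym; apply: vM.
  exact: leq_maxr.
have /nbhs_ballP[e /= e0 eU] : nbhs x U by exact: open_nbhs_nbhs.
have [n ne] : exists n : nat, (n.+1%:R^-1 <= e / 2)%R.
  exists (Num.truncn (e / 2)^-1); rewrite invf_ple ?posrE// ?divr_gt0//.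
  by apply/ltW; rewrite truncnS_gt.
have e20 : (0 < e / 2)%R by rewrite divr_gt0.
have [N _ vN] := (@cvg_ballP _ _ _ _ _ _ _).1 vx _ e20.
exists n, N => k Nk y ky; apply: eU; apply: (ball_split (z := v k)).
  exact: vN.
exact: le_ball ky.
Qed.

Lemma measurable_preimage_lim (U : set S) : open U ->
  measurable [set z : ipower nat | U (lim_at z)].
Proof.
move=> oU.
pose C (z : ipower nat) := forall e : nat, exists N : nat, forall k l : nat,
    (N <= k)%N -> (N <= l)%N -> ball (u (z k)) (e.+1%:R^-1 : R) (u (z l)).
have mz (i j : nat) : measurable [set z : ipower nat | z i = j].
  by apply: (@mset_preimage _ _ _ _ (fun z : ipower nat => z i) [set j]) => //;
    exact: measurable_icoord.
have m1 (Q : nat -> Prop) i : measurable [set z : ipower nat | Q (z i)].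
  exact: (@mset_count _ _ _ (fun z : ipower nat => z i)).
have m2 (Q : nat * nat -> Prop) i j :
    measurable [set z : ipower nat | Q (z i, z j)].
  apply: (@mset_count _ _ _ (fun z : ipower nat => (z i, z j))) => -[a b].
  rewrite (_ : mkset _ = [set z | z i = a /\ z j = b]); first exact: mset_and.
  by apply/seteqP; split => z /= [-> ->].
have mC : measurable [set z | C z].
  apply: mset_all => e; apply: mset_ex => N; apply: mset_all => k.
  apply: mset_all => l.
  exact: (m2 (fun ab => (N <= k)%N -> (N <= l)%N ->
    ball (u ab.1) (e.+1%:R^-1 : R) (u ab.2))).
(* On divergent sequences [lim] takes the default value [point], which accounts for the second
   alternative. *)
rewrite (_ : mkset _ = [set z | (C z /\ exists e N : nat, forall k : nat,
   (N <= k)%N -> ball (u (z k)) (e.+1%:R^-1 : R) `<=` U) \/ (~ C z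
     /\ U point)]).
  apply: mset_or; apply: mset_and => //; last 2 first.
  - exact: mset_not.
  - exact: mset_cst.
  apply: mset_ex => e; apply: mset_ex => N; apply: mset_all => k.
  exact: (m1 (fun a => (N <= k)%N -> ball (u a) (e.+1%:R^-1 : R) `<=` U)).
apply/seteqP; split => z /=.
  have [Cz|nCz] := pselect (C z).
    by left; split=> //; apply/(open_limP (x := lim_at z)) => //;
      exact/seq_cauchyP.
  by rewrite dvgP; [right|move/seq_cauchyP].
move=> [[Cz]|[nCz]]; last by rewrite dvgP// => /seq_cauchyP.
by apply: (open_limP _ _).2 => //; exact/seq_cauchyP.
Qed.

End polish_limit.

(** A point is coded by the least indices of dense points approximating it within 1, 1/2, 1/3 and so
    on, and is decoded as the limit of these dense points. *)
Lemma mretract_standard_borel (R : realType) d (X : measurableType d) :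
  standard_borel R X -> mretract X (ipower nat).
Proof.
move=> [S [f [hS [D cD dD] [g fg gf] mX]]].
have /countable_injP[phi phiI] := cD.
pose u n : S := xget point [set x | D x /\ phi x = n].
have uphi x : D x -> u (phi x) = x.
  move=> Dx; rewrite /u; case: xgetP => [y _ [Dy yx]|/(_ x)]; last by case.
  by apply: phiI; rewrite ?inE.
have mf (U : set S) : open U -> measurable [set x | U (f x)].
  move=> oU; rewrite -[measurable]/(d.-measurable) mX; exists U;
    rewrite ?setTI//.
  exact: sub_sigma_algebra.
pose e0 k : R := (k.+1%:R^-1)%R.
(* Balls of a pseudometric structure need not be open; their interiors are, and they still cover by
   halving the radius. *)
pose U k i : set S := (ball (u i) (e0 k))°.
have Uex k x : exists i, U k i x.
  have k0 : (0 < e0 k / 2)%R by rewrite divr_gt0// invr_gt0.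
  have [] := dD (ball x (e0 k / 2))°.
  - by exists x; apply: nbhsx_ballx.
  - exact: open_interior.
  move=> y [/interior_subset xy Dy]; exists (phi y); rewrite /U uphi//.
  apply/nbhs_ballP; exists (e0 k / 2)%R => //= t xt.
  by apply: ball_split (ball_sym xy) xt.
pose c (x : X) : ipower nat := fun k => least (fun i => `[< U k i (f x) >]).
have cU x k : U k (c x k) (f x).
  have [i Ui] := Uex k (f x).
  by apply/asboolP; apply: (@leastP (fun i => `[< U k i (f x) >]) i);
    exact/asboolP.
have cl x : u (c x k) @[k --> \oo] --> f x.
  apply/cvg_ballP => e ep.
  exists (Num.truncn e^-1) => // k /= ek.
  have := interior_subset (cU x k); move/ball_sym; apply: le_ball.
  rewrite /e0 invf_ple ?posrE//; apply/ltW.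
  apply: (lt_le_trans (truncnS_gt _)).
  by rewrite ler_nat.
exists c, (fun z => g (lim (u (z k) @[k --> \oo]))); split.
- apply: measurable_fun_ipower => k; apply: measurable_least => i.
  rewrite (_ : mkset _ = [set x | U k i (f x)]); first exact/mf/open_interior.
  by apply/seteqP; split => x /asboolP.
- move=> _ B; rewrite setTI -[measurable B]/(d.-measurable B) mX.
  move=> [B' sB' <-]; rewrite setTI.
  rewrite (_ : _ @^-1` _ = [set z : ipower nat | B' (lim (u (z k) @[k -->
    \oo]))]).
    pose G := [set B' | measurable [set z : ipower nat | B' (lim (u (z k) @[k
      --> \oo]))]].
    suff : <<s [set U : set S | open U] >> `<=` G by apply.
    apply: smallest_sub.
      split.
      - by rewrite /G/= (_ : mkset _ = set0)//.
      - by move=> A GA; rewrite setTD; exact: mset_not.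
      - by move=> F GF; rewrite /G/=;
        exact: (bigcup_measurable (fun i _ => GF i)).
    by move=> V oV; exact: measurable_preimage_lim.
  by apply/seteqP; split => z /=; rewrite gf.
- move=> x; rewrite (_ : lim _ = f x); first exact: fg.
  exact: (cvg_lim hS (cl x)).
Qed.

(** * Measurable subsets of the Baire space and closed graphs *)

Section unfolding.
Local Notation NN := (ipower nat).

(* A measurable set which unfolds is the injective projection of a closed
   subset of the Baire space; this is how a Polish topology is found on it. *)
Definition unfolds (A : set NN) : Prop := exists w : NN -> NN,
  measurable_fun setT w /\ forall b z,
    (forall n, exists b', [/\ A b', forall i, (i < n)%N -> b' i = b i &
                              forall i, (i < n)%N -> w b' i = z i]) ->
    A b /\ w b = z.

Lemma unfolds_icoord i (B : set nat) : unfolds [set z | B (z i)].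
Proof.
exists (fun=> fun=> 0%N); split=> // b z h; split.
  by have [b' [/= Bb' <-]] := h i.+1.
by apply/funext => j; have [b' [_ _ <-]] := h j.+1.
Qed.

Lemma unfolds_bigcap (F : nat -> set NN) :
  (forall n, unfolds (F n)) -> unfolds (\bigcap_n F n).
Proof.
move=> /choice[w wP].
(* All the witnesses are interleaved into one sequence. With [pickle_inv], places that code no pair
   carry 0, so every other place is exactly the code of its pair. *)
exists (fun b k => oapp (fun p => w p.1 b p.2) 0%N (pickle_inv k)); split.
  apply: measurable_fun_ipower => k; case: (pickle_inv k) => [[n m]|//] /=.
  have [mw _] := wP n.
  exact: (measurableT_comp (measurable_icoord m) mw).
move=> b z h.
have hb n : F n b /\ w n b = fun m => z (pickle (n, m)).
  apply: (wP n).2 => k.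
  have [b' [Fb' bb' wz]] :=
    (* Far enough to see the first [k] entries of [b] and the codes of the first [k] entries of the
       [n]-th witness. *)
    h (maxn k (\max_(m < k) (pickle (n, nat_of_ord m)).+1)).
  exists b'; split; first exact: Fb'.
    by move=> i ik; apply: bb'; rewrite leq_max ik.
  move=> i ik; rewrite -wz.
    by rewrite pickleK_inv.
  rewrite leq_max; apply/orP; right.
  exact: (@leq_bigmax _ (fun m : 'I_k => (pickle (n,
    nat_of_ord m)).+1) (Ordinal ik)).
split=> [n _|]; first by have [] := hb n.
apply/funext => k.
case E : (pickle_inv k) => [[n m]|] /=.
  have [_ ->] := hb n.
  by have := @pickle_invK (nat * nat)%type k; rewrite E /= => ->.
by have [b' [_ _ /(_ k (ltnSn k))]] := h k.+1; rewrite E.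
Qed.

(** The new witness starts with the index of the piece containing the point, which disjointness
    makes unique. Approximating points then all lie in the piece named by [z 0], where the witness
    of that piece applies. *)
Lemma unfolds_bigcup (F : nat -> set NN) : (forall n, measurable (F n)) ->
  trivIset setT F -> (forall n, unfolds (F n)) -> unfolds (\bigcup_n F n).
Proof.
move=> mF tF /choice[w wP].
pose m b := least (fun n => `[< F n b >]).
have mm : measurable_fun setT m.
  apply: measurable_least => i; rewrite (_ : mkset _ = F i)//.
  by apply/seteqP; split => x /asboolP.
have mE b n : F n b -> m b = n.
  move=> Fn; have Fm : F (m b) b.
    by apply/asboolP/(@leastP (fun n => `[< F n b >]) n); exact/asboolP.
  by apply: tF => //; exists b.
exists (fun b k => if k is k'.+1 then w (m b) b k' else m b); split.
  apply: measurable_fun_ipower => -[//|k]; apply: measurable_fun_nat => j.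
  rewrite (_ : mkset _ = [set b | exists n, m b = n /\ w n b k = j]).
    apply: mset_ex => n; apply: mset_and.
      by apply: (mset_preimage (B := [set n])).
    have [mw _] := wP n.
    apply: (@mset_preimage _ _ _ _ (fun b => w n b k) [set j]) => //.
    exact: (measurableT_comp (measurable_icoord k) mw).
  by apply/seteqP; split => b /=; [exists (m b)|move=> [n [->]]].
move=> b z h.
have [Fb wb] : F (z 0%N) b /\ w (z 0%N) b = fun k => z k.+1.
  apply: (wP (z 0%N)).2 => k.
  have [b' [[n _ Fnb'] bb' wz]] := h k.+1.
  have nz : z 0%N = n by rewrite -wz// (mE _ _ Fnb').
  exists b'; split; first by rewrite nz.
    by move=> i ik; apply: bb'; exact: leqW.
  by move=> i ik; rewrite -(wz i.+1)// nz (mE _ _ Fnb').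
split; first by exists (z 0%N).
apply/funext => -[|k]; first exact: mE.
by rewrite (mE _ _ Fb) wb.
Qed.

(** Unfolding is not visibly stable under complement, so the induction carries a set together with
    its complement. This also allows a union to be made disjoint: each difference is a countable
    intersection of sets and complements already treated. *)
Lemma measurable_unfolds (A : set NN) : measurable A -> unfolds A.
Proof.
pose G : set (set NN) := [set A | [/\ measurable A,
  unfolds A & unfolds (~` A)]].
suff : (@measurable _ NN) `<=` G by move=> h /h[].
have G0 : G set0.
  split=> //; have := unfolds_icoord 0 set0; have := unfolds_icoord 0 setT.
    by [].
  by rewrite setC0.
apply: smallest_sub.
  split=> //.
    move=> B [mB uB uB']; rewrite setTD; split; [exact: measurableC|by []|].
    by rewrite setCK.
  move=> F GF.
  have mF i : measurable (F i) by have [] := GF i.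
  have u1 : unfolds (~` \bigcup_k F k).
    by rewrite setC_bigcup; apply: unfolds_bigcap => n; have [] := GF n.
  split=> //; first exact: bigcup_measurable.
  rewrite seqDU_bigcup_eq; apply: unfolds_bigcup.
  - move=> n; apply: measurableD => //; exact: bigsetU_measurable.
  - exact: trivIset_seqDU.
  move=> n; rewrite /seqDU.
  rewrite (_ : _ `\` _ = \bigcap_k (if (k < n)%N then ~` F k else F n)).
    by apply: unfolds_bigcap => k; case: ifP => _;
      [have [] := GF k|have [] := GF n].
  apply/seteqP; split => x /=.
    move=> [Fn nF] k _; case: ifP => // kn Fk; apply: nF.
    by rewrite -bigcup_mkord; exists k.
  move=> h; split; first by have := h n I; rewrite ltnn.
  by rewrite -bigcup_mkord => -[k /= kn Fk]; have := h k I; rewrite kn.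
move=> _ [i _ [B mB <-]]; rewrite setTI; split.
- exact: (mset_preimage (measurable_icoord i) mB).
- exact: unfolds_icoord.
- exact: (unfolds_icoord i (~` B)).
Qed.

End unfolding.

(** * Polish topologies from closed sets of branches *)

Section tree_space.
Local Open Scope ring_scope.
Context (R : realType) (T : pointedType) (V : countType) (v : T -> nat -> V).

(** Says that [v] identifies [T] with a closed subset of the product of countably many copies of the
    discrete space [V]. *)
Definition tree_closed : Prop := injective v /\ forall z : nat -> V,
  (forall n, exists x, forall i, (i < n)%N -> v x i = z i) -> exists x, v x = z.

Hypothesis vC : tree_closed.

(* T with the ultrametric which compares branches: points at distance less
   than 1 / i agree on the first i nodes *)
Definition tree_space (K : realType) (_ : tree_closed) : Type := T.
Local Notation TS := (tree_space R vC).

HB.instance Definition _ := Pointed.on TS.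

Definition tree_ball (x : TS) (e : R) (y : TS) : Prop :=
  0 < e /\ forall i : nat, e <= i.+1%:R^-1 -> v x i = v y i.

Let tball_center x (e : R) : 0 < e -> tree_ball x e x.
Proof. by []. Qed.

Let tball_sym x y (e : R) : tree_ball x e y -> tree_ball y e x.
Proof. by move=> [e0 h]; split=> // i /h. Qed.

Let tball_triangle x y z (e1 e2 : R) :
  tree_ball x e1 y -> tree_ball y e2 z -> tree_ball x (e1 + e2) z.
Proof.
move=> [e10 h1] [e20 h2]; split=> [|i ei]; first exact: addr_gt0.
rewrite h1 ?h2//; apply: le_trans ei.
  by rewrite lerDr ltW.
by rewrite lerDl ltW.
Qed.

HB.instance Definition _ := hasNbhs.Build TS (nbhs_ (entourage_ tree_ball)).

HB.instance Definition _ := @Nbhs_isPseudoMetric.Build R TS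
  (entourage_ tree_ball) erefl tree_ball tball_center tball_sym tball_triangle
  erefl.

Let tballE (x : TS) n (y : TS) :
  ball x (n.+1%:R^-1 : R) y <-> forall i, (i <= n)%N -> v x i = v y i.
Proof.
split=> [[_ h] i ni|h].
  by apply: h; rewrite lef_pV2 ?posrE// ler_nat.
split=> [|i]; first by rewrite invr_gt0.
by rewrite lef_pV2 ?posrE// ler_nat ltnS; exact: h.
Qed.

Let tball_exists (e : R) : 0 < e -> exists n : nat, n.+1%:R^-1 <= e.
Proof.
move=> e0; exists (Num.truncn e^-1); rewrite invf_ple ?posrE//.
by apply/ltW; rewrite truncnS_gt.
Qed.

Let tree_complete (F : set_system TS) : ProperFilter F -> cauchy F -> cvg F.
Proof.
move=> FF cF.
have cex : cauchy_ex F by exact/cauchyP.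
have /choice[x xP] n : exists x : TS, F (ball x (n.+1%:R^-1 : R)).
  by apply: cex; rewrite invr_gt0.
have xE m n i : (i <= m)%N -> (i <= n)%N -> v (x m) i = v (x n) i.
  move=> im iN.
  have [y [/tballE ym /tballE yn]] := filter_ex (filterI (xP m) (xP n)).
  by rewrite ym// yn.
(* The limit branch is the diagonal of the centres; its initial segments are realised by the centres
   themselves, so closedness provides a point. *)
have [y vy] : exists y, v y = fun n => v (x n) n.
  by apply: vC.2 => n; exists (x n) => i ni; apply: xE => //; exact: ltnW.
apply/cvg_ex; exists y; apply/fcvg_ballP => e e0.
have [n ne] := tball_exists e0.
apply: filterS (xP n) => t /tballE xt; apply: (le_ball ne);
  apply/tballE => i ni.
by rewrite vy -xt//; exact: xE.
Qed.

HB.instance Definition _ := Uniform_isComplete.Build TS tree_complete.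

Lemma tree_hausdorff : hausdorff_space TS.
Proof.
rewrite (@ball_hausdorff R) => a b ab.
have [i abi] : exists i, v a i <> v b i.
  apply/existsNP => h; move/eqP: ab; apply; apply: vC.1; exact/funext.
have i0 : 0 < i.+1%:R^-1 :> R by rewrite invr_gt0.
exists (PosNum i0, PosNum i0) => /=; apply/eqP/seteqP;
  split=> // t [/= /tballE at_ /tballE bt].
by apply: abi; rewrite at_// bt.
Qed.

Let node (s : seq V) : set TS := [set x | mkseq (v x) (size s) = s].

Let node_ball (x : TS) n : node (mkseq (v x) n.+1) `<=` ball x (n.+1%:R^-1 : R).
Proof.
move=> y; rewrite /node /mkset size_mkseq => yx; apply/tballE => i ni.
by have /(congr1 (fun s => nth (v x 0%N) s i)) := yx; rewrite !nth_mkseq.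
Qed.

Lemma tree_separable : exists2 D : set TS, countable D & dense D.
Proof.
exists (range (fun s => xget point (node s))).
  exact: (sub_countable (card_image_le _ _)).
move=> O [x Ox] oO; have /nbhs_ballP[e /= e0 eO] : nbhs x O by exact:
  open_nbhs_nbhs.
have [n ne] := tball_exists e0.
pose s := mkseq (v x) n.+1.
exists (xget point (node s)); split; last by exists s.
apply: eO; apply: (le_ball ne); apply: node_ball.
by apply: (@xgetPex _ point (node s)); exists x;
  rewrite /node /mkset size_mkseq.
Qed.

(** There are only countably many finite strings, so every open set is a countable union of nodes;
    measurability of open sets reduces to that of nodes. *)
Lemma tree_open (O : set TS) : open O ->
  O = \bigcup_(s in [set s | node s `<=` O]) node s.
Proof.
move=> oO; apply/seteqP; split=> [x Ox|x [s]]; last exact.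
have /nbhs_ballP[e /= e0 eO] : nbhs x O by exact: open_nbhs_nbhs.
have [n ne] := tball_exists e0.
exists (mkseq (v x) n.+1); last by rewrite /node /mkset size_mkseq.
by move=> y /node_ball /(le_ball ne) /eO.
Qed.

Lemma open_node i a : open [set x : TS | v x i = a].
Proof.
rewrite openE => x /= xa; apply/nbhs_ballP; exists (i.+1%:R^-1) => /=.
  by rewrite invr_gt0.
by move=> y /tballE/(_ i (leqnn i)) xy /=; rewrite -xy.
Qed.

End tree_space.

(** The image of [c] is the set of fixed points of [c] after [l], hence measurable, so it unfolds.
    Adjoining the witness [w] to the code [c x] turns this image into a closed set of branches,
    whose topology is pulled back to [X]. *)
Lemma standard_borel_mretract (R : realType) d (X : measurableType d) :
  mretract X (ipower nat) -> standard_borel R X.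
Proof.
move=> [c [l [mc ml cl]]].
pose A : set (ipower nat) := [set z | c (l z) = z].
have mA : measurable A.
  rewrite (_ : A = [set z | forall i, exists j, c (l z) i = j /\ z i = j]);
    last first.
    apply/seteqP; split => z /=; first by move=> zz i; exists (z i); rewrite zz.
    by move=> h; apply/funext => i; have [j [-> ->]] := h i.
  have mi := measurable_icoord (X := nat).
  apply: mset_all => i; apply: mset_ex => j; apply: mset_and.
    apply: (@mset_preimage _ _ _ _ (fun z => c (l z) i) [set j]) => //.
    exact: (measurableT_comp (mi i) (measurableT_comp mc ml)).
  exact: (@mset_preimage _ _ _ _ (fun z : ipower nat => z i) [set j]).
have [w [mw wP]] := measurable_unfolds mA.
pose v (x : X) (i : nat) : (nat * nat)%type := (c x i, w (c x) i).
have Ac x : A (c x) by rewrite /A/= cl.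
have vC : tree_closed v.
  split=> [x y xy|z h].
    rewrite -(cl x) -(cl y); congr l; apply/funext => i.
    by have /(congr1 (fun u => (u i).1)) := xy.
  have [Az wz] : A (fun i => (z i).1) /\ w (fun i => (z i).1) = (fun i =>
    (z i).2).
    apply: wP => n; have [x vx] := h n.
    by exists (c x); split=> // i ni; rewrite -vx.
  exists (l (fun i => (z i).1)); apply/funext => i.
  by rewrite /v Az wz -surjective_pairing.
have mv i a : measurable [set x | v x i = a].
  case: a => a1 a2.
  rewrite (_ : mkset _ = [set x | c x i = a1 /\ w (c x) i = a2]).
    apply: mset_and.
      apply: (@mset_preimage _ _ _ _ (fun x => c x i) [set a1]) => //.
      exact: (measurableT_comp (measurable_icoord i) mc).
    apply: (@mset_preimage _ _ _ _ (fun x => w (c x) i) [set a2]) => //.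
    exact: (measurableT_comp (measurable_icoord i) (measurableT_comp mw mc)).
  by apply/seteqP; split => x /=; [move=> [<- <-]|rewrite /v => -[-> ->]].
exists (tree_space R vC), id; split.
- exact: tree_hausdorff.
- exact: tree_separable.
- by exists id.
rewrite (_ : preimage_set_system _ _ _ =
             <<s [set U : set (tree_space R vC) | open U] >>); last first.
  by apply/seteqP; split=> B; [move=> [C sC <-]; rewrite setTI|
                               exists B; rewrite ?setTI].
apply/seteqP; split; last first.
  apply: smallest_sub; first exact: sigma_algebra_measurable.
  move=> O /tree_open ->; rewrite bigcup_mkcond.
  apply: countable_bigcupT_measurable; first exact: countableP.
  move=> s; case: ifP => // _.
  rewrite (_ : mkset _ = [set x | forall i : 'I_(size s), v x i = nth (0%N,
    0%N) s i]).
    exact: mset_all.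
  apply/seteqP; split => x /=.
    by move=> <- i; rewrite nth_mkseq// -[X in (_ < X)%N](size_mkseq (v x)).
  move=> h; apply: (@eq_from_nth _ (0%N, 0%N)); rewrite size_mkseq// => i ni.
  by rewrite nth_mkseq// (h (Ordinal ni)).
move=> B mB.
pose G : set (set (ipower nat)) := [set C |
  <<s [set U : set (tree_space R vC) | open U] >> (c @^-1` C)].
have GmG : (@measurable _ (ipower nat)) `<=` G.
  apply: smallest_sub.
    split.
    - by rewrite /G /= preimage_set0; exact: sigma_algebra0.
    - by move=> C GC; rewrite /G/= setTD preimage_setC; exact: sigma_algebraC.
    - move=> F GF; rewrite /G/= preimage_bigcup; exact: sigma_algebra_bigcup.
  move=> _ [i _ [C _ <-]]; apply: sub_sigma_algebra => /=.
  rewrite (_ : _ @^-1` _ = \bigcup_(a in [set a | C a.1]) [set x : tree_space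
    R vC | v x i = a]).
    by apply: bigcup_open => a _; exact: open_node.
  rewrite setTI; apply/seteqP; split => x /=; first by exists (v x i).
  by move=> [a /= Ca xa]; move: Ca; rewrite -xa.
have := GmG (l @^-1` B); rewrite /G/= -comp_preimage.
have -> : l \o c = id by apply/funext => x; exact: cl.
by apply; have := ml measurableT B mB; rewrite setTI.
Qed.

Lemma standard_borelP (R : realType) d (X : measurableType d) :
  standard_borel R X <-> mretract X (ipower nat).
Proof.
by split; [exact: mretract_standard_borel|exact: standard_borel_mretract].
Qed.

(** * Probability measures on the Cantor space *)

Section image_prob.
Context d d' (X : measurableType d) (Y : measurableType d') (R : realType).
Variables (f : X -> Y) (mf : measurable_fun setT f) (P : probability X R).

Let image := pushforward P f.

Let image0 : image set0 = 0. Proof. exact: measure0. Qed.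

Let image_ge0 A : 0 <= image A. Proof. exact: measure_ge0. Qed.

Let image_sigma_additive : semi_sigma_additive image.
Proof. exact: measure_semi_sigma_additive. Qed.

HB.instance Definition _ := isMeasure.Build _ _ _ image
  image0 image_ge0 image_sigma_additive.

Let imageT : image setT = 1.
Proof. exact: probability_setT. Qed.

HB.instance Definition _ := Measure_isProbability.Build _ _ _ image imageT.

Definition image_prob : probability Y R := image.

Lemma image_probE B : image_prob B = P (f @^-1` B). Proof. by []. Qed.

Lemma ge0_integral_image_prob (h : Y -> \bar R) : measurable_fun setT h ->
  (forall y, 0 <= h y) -> \int[image_prob]_y h y = \int[P]_x h (f x).
Proof.
by move=> mh h0; rewrite ge0_integral_pushforward.
Qed.

End image_prob.

Lemma probability_unique d (T : measurableType d) (R : realType)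
    (P Q : probability T R) (G : set (set T)) :
  @measurable _ T = <<s G >> -> setI_closed G -> G setT ->
  (forall A, G A -> P A = Q A) -> forall A, measurable A -> P A = Q A.
Proof.
move=> mG IG GT PQ A mA; apply: (@measure_unique _ _ _ G (fun=> setT)) => //.
- by rewrite bigcup_const.
- by move=> _; rewrite /= probability_setT ltry.
Qed.

Lemma standard_borel_realType (R : realType) : standard_borel R R.
Proof.
exists R, id; split.
- exact: Rhausdorff.
- exists (range (@ratr R)); first exact: (sub_countable (card_image_le _ _)).
  exact: dense_rat.
- by exists id.
rewrite (_ : preimage_set_system _ _ _ = <<s [set U : set R | open U] >>);
  last first.
  by apply/seteqP; split=> B; [move=> [C sC <-]; rewrite setTI|
                               exists B; rewrite ?setTI].
apply/seteqP; split.
  rewrite [X in X `<=` _](RGenOpens.measurableE R).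
  apply: smallest_sub; first exact: smallest_sigma_algebra.
  by move=> _ [x [y ->]]; apply: sub_sigma_algebra; exact: interval_open.
apply: smallest_sub; first exact: sigma_algebra_measurable.
by move=> U; exact: open_measurable.
Qed.

(** * Cylinders of the Cantor space *)

Section cylinders_of_bits.
Local Notation C := (ipower bool).

Definition cyl (s : seq bool) : set C := [set b | mkseq b (size s) = s].

(** The empty set is added for closure under intersection: two cylinders are nested or disjoint. *)
Definition cyls : set (set C) := [set A | A = set0 \/ exists s, A = cyl s].

Lemma measurable_cyl s : measurable (cyl s).
Proof.
have mn (b : bool) i : measurable [set x : C | x i = b].
  apply: (@mset_preimage _ _ _ _ (fun x : C => x i) [set b]) => //.
  exact: measurable_icoord.
rewrite (_ : cyl s = [set x | forall i : 'I_(size s), x i = nth false s i]).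
  by apply: mset_all => i; exact: mn.
apply/seteqP; split => x /=.
  by move=> /(congr1 (nth false)) xs i; rewrite -xs nth_mkseq.
move=> h; apply: (@eq_from_nth _ false); rewrite size_mkseq// => i ni.
by rewrite nth_mkseq// (h (Ordinal ni)).
Qed.

Lemma measurable_cyls A : cyls A -> measurable A.
Proof. by move=> [->|[s ->]]; [|exact: measurable_cyl]. Qed.

Lemma cylsT : cyls setT.
Proof. by right; exists [::]; apply/seteqP; split. Qed.

Lemma cylsI : setI_closed cyls.
Proof.
move=> A B [->|[s ->]]; first by rewrite set0I; left.
move=> [->|[t ->]]; first by rewrite setI0; left.
wlog st : s t / (size s <= size t)%N.
  move=> h; have [st|/ltnW ts] := leqP (size s) (size t); first exact: h.
  by rewrite setIC; exact: h.
have tE (x : C) : cyl t x -> mkseq x (size s) = take (size s) t.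
  by move=> <-; rewrite /mkseq -map_take take_iota (minn_idPl st).
have [ts|ts] := eqVneq (take (size s) t) s.
  right; exists t; apply/seteqP; split=> [x []//|x tx]; split=> //.
  by rewrite /cyl/= (tE _ tx).
left; apply/seteqP; split=> // x [sx /tE tx]; move/eqP: ts; apply.
by rewrite -tx.
Qed.

Lemma cyls_gen : @measurable _ C = <<s cyls >>.
Proof.
apply/seteqP; split; last first.
  apply: smallest_sub; first exact: sigma_algebra_measurable.
  exact: measurable_cyls.
apply: smallest_sub; first exact: smallest_sigma_algebra.
move=> _ [i _ [B mB <-]]; rewrite setTI.
pose F n : set C := if unpickle n is Some s then
  if `[< size s = i.+1 /\ B (nth false s i) >] then cyl s else set0 else set0.
rewrite (_ : _ @^-1` _ = \bigcup_n F n).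
  apply: sigma_algebra_bigcup => n; apply: sub_sigma_algebra; rewrite /F.
  by case: (unpickle n) => [s|]; [case: ifP => _; [right; exists s|left]|left].
apply/seteqP; split => x /=.
  move=> Bx; exists (pickle (mkseq x i.+1)) => //; rewrite /F pickleK asboolT.
    by rewrite /cyl /mkset size_mkseq.
  by rewrite size_mkseq nth_mkseq.
move=> [n _]; rewrite /F; case: (unpickle n) => [s|//];
  case: asboolP => // -[si Bs].
by rewrite /cyl /mkset si => sx; move: Bs; rewrite -sx nth_mkseq.
Qed.

Lemma cyl_rcons s : cyl s = cyl (rcons s false) `|` cyl (rcons s true).
Proof.
apply/seteqP; rewrite /cyl /setU /mkset !size_rcons; split => x /=.
  by rewrite !mkseqS => ->; case: (x _); [right|left].
by rewrite !mkseqS => -[] /rcons_inj[].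
Qed.

Lemma cyl_rcons_disj s : cyl (rcons s false) `&` cyl (rcons s true) = set0.
Proof.
apply/seteqP; split => // x [].
rewrite /cyl /mkset !size_rcons !mkseqS => /rcons_inj[_ ->].
by move=> /rcons_inj[].
Qed.

End cylinders_of_bits.

(** * Laws with prescribed masses on the cylinders *)

Section tree_law.
Local Open Scope ring_scope.
Context (R : realType).
Local Notation C := (ipower bool).

Definition mass (f : ipower R) (s : seq bool) : R := f (pickle s).

Definition consistent (f : ipower R) : Prop :=
  [/\ mass f [::] = 1, forall s, 0 <= mass f s &
      forall s, mass f s = mass f (rcons s false) + mass f (rcons s true)].

(* [0, 1[ is cut into consecutive intervals of lengths mass f s, ordered
   lexicographically, for the strings s of each given length *)
Definition left_end (f : ipower R) (s : seq bool) : R :=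
  (foldl (fun pa t => (rcons pa.1 t,
                       if t then pa.2 + mass f (rcons pa.1 false) else pa.2))
         ([::], 0) s).2.

Lemma left_end0 f : left_end f [::] = 0. Proof. by []. Qed.

Lemma left_end_rcons f s t : left_end f (rcons s t) =
  if t then left_end f s + mass f (rcons s false) else left_end f s.
Proof.
rewrite /left_end foldl_rcons /=; case: t => //; congr (_ + mass f (rcons _ _)).
elim/last_ind: s => [//|s t ih].
by rewrite foldl_rcons /= ih.
Qed.

Fixpoint prefix (f : ipower R) (u : R) n : seq bool :=
  if n is n'.+1 then
    let s := prefix f u n' in
    rcons s (left_end f s + mass f (rcons s false) <= u)
  else [::].

Definition branch (f : ipower R) (u : R) : C := fun n =>
  left_end f (prefix f u n) + mass f (rcons (prefix f u n) false) <= u.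

Lemma mkseq_branch f u n : mkseq (branch f u) n = prefix f u n.
Proof. by elim: n => [//|n ih]; rewrite mkseqS ih. Qed.

(** By consistency the intervals of the two extensions of a string partition its own interval, and
    the next bit tells on which side of the cut [u] lies. Half-open intervals make the partition
    exact. *)
Lemma prefixP f u n s : consistent f -> 0 <= u < 1 -> prefix f u n = s <->
  size s = n /\ left_end f s <= u < left_end f s + mass f s.
Proof.
move=> [f1 f0 fD] u01; elim: n s => [|n ih] s.
  split=> [<-/=|[/size0nil -> //]].
  by rewrite left_end0 f1 add0r.
elim/last_ind: s => [|s t _]; first by split=> [/(congr1 size)|[]//];
  rewrite size_rcons.
rewrite size_rcons left_end_rcons /=.
have h0 := f0 (rcons s false); have h1 := f0 (rcons s true); have hD := fD s.
split.
  move=> /rcons_inj[ps <-]; have /ih[sn /andP[su us]] := ps.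
  split; first by rewrite sn.
  rewrite ps; case: ifPn => [h|]; first by apply/andP; split; lra.
  by rewrite -ltNge => h; apply/andP; split; lra.
move=> [[sn] tu].
have -> : prefix f u n = s.
  by apply/ih; split=> //; case: t tu => /andP[? ?]; apply/andP; split; lra.
congr rcons; case: t tu => /andP[? ?]; first by [].
by apply/negbTE; rewrite -ltNge.
Qed.

Lemma left_end_ge0 f s : consistent f -> 0 <= left_end f s.
Proof.
move=> [_ f0 _]; elim/last_ind: s => [//|s t ih].
by rewrite left_end_rcons; case: t => //; exact: addr_ge0.
Qed.

Lemma right_end_le1 f s : consistent f -> left_end f s + mass f s <= 1.
Proof.
move=> [f1 f0 fD]; elim/last_ind: s => [|s t ih];
  first by rewrite left_end0 f1 add0r.
have := fD s; have := f0 (rcons s false); have := f0 (rcons s true).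
by rewrite left_end_rcons; case: t; lra.
Qed.

Lemma measurable_mass s : measurable_fun setT (mass ^~ s).
Proof. exact: measurable_icoord. Qed.

Lemma measurable_left_end s : measurable_fun setT (left_end ^~ s).
Proof.
elim/last_ind: s => [|s t ih]; first exact: measurable_cst.
under eq_fun do rewrite left_end_rcons.
by case: t => //; apply: measurable_funD => //; exact: measurable_mass.
Qed.

Lemma measurable_prefix n s :
  measurable [set fu : ipower R * R | prefix fu.1 fu.2 n = s].
Proof.
elim: n s => [|n ih] s; first exact: (mset_cst _ ([::] = s)).
elim/last_ind: s => [|s t _].
  rewrite (_ : mkset _ = set0)//; apply/seteqP; split=> // fu /= /(congr1 size).
  by rewrite size_rcons.
rewrite (_ : mkset _ = [set fu | prefix fu.1 fu.2 n = s /\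
    (left_end fu.1 s + mass fu.1 (rcons s false) <= fu.2) = t]).
  apply: mset_and => //.
  apply: (@mset_preimage _ _ _ _ (fun fu : ipower R * R =>
    left_end fu.1 s + mass fu.1 (rcons s false) <= fu.2) [set t]) => //.
  apply: measurable_fun_ler; last exact: measurable_snd.
  apply: measurable_funD.
    exact: (measurableT_comp (measurable_left_end s) measurable_fst).
  exact: (measurableT_comp (measurable_mass _) measurable_fst).
apply/seteqP; split => fu /=; first by move=> /rcons_inj[ps <-]; rewrite ps.
by move=> [-> ->].
Qed.

(** Joint measurability in the masses and in the point [u] is needed: the law of a measurable set is
    then the measure of a section, which is measurable in [f]. *)
Lemma measurable_branch :
  measurable_fun setT (fun fu : ipower R * R => branch fu.1 fu.2).
Proof.
apply: measurable_fun_ipower => n; apply: measurable_fun_boolP.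
rewrite (_ : mkset _ = [set fu : ipower R * R |
    nth false (prefix fu.1 fu.2 n.+1) n]).
  exact: (@mset_count _ _ _ (fun fu : ipower R * R => prefix fu.1 fu.2 n.+1)
    (fun s => nth false s n) (measurable_prefix _)).
by apply/seteqP; split => fu;
  rewrite /mkset -mkseq_branch mkseqS nth_rcons size_mkseq ltnn eqxx.
Qed.

Let unit_itv : set R := `[0, 1[.

Let munit : measurable unit_itv. Proof. exact: measurable_itv. Qed.

Definition unif : set R -> \bar R := mrestr (@lebesgue_measure R) munit.

Let unif0 : unif set0 = 0%E.
Proof. exact: (measure0 (mrestr (@lebesgue_measure R) munit)). Qed.

Let unif_ge0 A : (0 <= unif A)%E.
Proof. exact: (measure_ge0 (mrestr (@lebesgue_measure R) munit)). Qed.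

Let unif_sigma_additive : semi_sigma_additive unif.
Proof.
exact: (@measure_semi_sigma_additive _ _ _ (mrestr (@lebesgue_measure R)
  munit)).
Qed.

HB.instance Definition _ := isMeasure.Build _ _ _ unif
  unif0 unif_ge0 unif_sigma_additive.

Let unifT : unif setT = 1%E.
Proof. by rewrite /unif /mrestr setTI lebesgue_measure_itv /= lte_fin ltr01
  sube0. Qed.

HB.instance Definition _ := Measure_isProbability.Build _ _ _ unif unifT.

Lemma measurable_branch1 f : measurable_fun setT (branch f).
Proof. exact: (measurableT_comp measurable_branch (measurable_pair1 f)). Qed.

Definition tree_law (f : ipower R) : pspace C R :=
  pspace_of (image_prob (measurable_branch1 f) unif).

Lemma tree_lawE f A : measurable A -> tree_law f A = unif (branch f @^-1` A).
Proof. by move=> mA; rewrite pspace_ofE. Qed.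

Lemma measurable_tree_law : measurable_fun setT tree_law.
Proof.
apply: measurable_fun_pspace => A mA.
under eq_fun do rewrite tree_lawE//.
have := measurable_fun_xsection unif (mset_preimage measurable_branch mA).
congr measurable_fun; apply/funext => f; rewrite /comp; congr (unif _).
by apply/seteqP; split=> u; rewrite /xsection/= inE.
Qed.

Lemma tree_law_cyl f s : consistent f -> tree_law f (cyl s) = (mass f s)%:E.
Proof.
move=> cf; rewrite tree_lawE; last exact: measurable_cyl.
rewrite /unif /mrestr.
rewrite (_ : _ `&` _ = `[left_end f s, left_end f s + mass f s[%classic).
  rewrite lebesgue_measure_itv/= lte_fin ltrDl; have [_ f0 _] := cf.
  (* The length formula distinguishes empty intervals, which occur exactly for strings of mass 0. *)
  have := f0 s; rewrite le_eqVlt => /orP[/eqP <-|->]; first by rewrite ltxx.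
  by rewrite -EFinB addrAC subrr add0r.
have l0 := left_end_ge0 s cf; have r1 := right_end_le1 s cf.
apply/seteqP; split => u /=.
  rewrite /cyl /mkset mkseq_branch /unit_itv/= !in_itv/= => -[+ u01].
  by move=> /(prefixP _ _ cf u01)[].
rewrite /cyl /mkset mkseq_branch /unit_itv/= !in_itv/= => /andP[lu ur].
have u01 : 0 <= u < 1 by apply/andP; split; lra.
by split=> //; apply/(prefixP _ _ cf u01); rewrite lu ur.
Qed.

Definition masses (r : pspace C R) : ipower R :=
  fun n => oapp (fun s => fine (r (cyl s))) 0 (unpickle n).

Lemma mass_masses r s : mass (masses r) s = fine (r (cyl s)).
Proof. by rewrite /mass /masses pickleK. Qed.

Lemma measurable_masses : measurable_fun setT masses.
Proof.
apply: measurable_fun_ipower => n; rewrite /masses;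
  case: (unpickle n) => [s|] //=.
apply: (measurableT_comp (@fine_measurable _ setT measurableT)).
exact: (measurable_pspace_ev (measurable_cyl s)).
Qed.

Lemma consistent_masses r : consistent (masses r).
Proof.
split=> [|s|s]; rewrite !mass_masses ?fine_ge0//.
  rewrite (_ : cyl [::] = setT) ?probability_setT//.
  by apply/seteqP; split.
rewrite -fineD; last 2 first.
- by apply: fin_num_measure; exact: measurable_cyl.
- by apply: fin_num_measure; exact: measurable_cyl.
congr fine; rewrite [in LHS]cyl_rcons measureU//; try exact: measurable_cyl.
exact: cyl_rcons_disj.
Qed.

Lemma cyl_eq (r r' : pspace C R) : (forall s, r (cyl s) = r' (cyl s)) -> r = r'.
Proof.
move=> h; apply: pspace_eq; apply: (probability_unique cyls_gen cylsI cylsT).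
by move=> _ [->|[s ->]]; rewrite ?measure0.
Qed.

Lemma masses_tree_law : cancel masses tree_law.
Proof.
move=> r; apply: cyl_eq => s; rewrite tree_law_cyl;
  last exact: consistent_masses.
rewrite mass_masses fineK//; apply: fin_num_measure; exact: measurable_cyl.
Qed.

End tree_law.

(** * Limiting frequencies of exchangeable sequences *)

Section bounded_measurable.
Local Open Scope ring_scope.
Context d (T : measurableType d) (R : realType) (P : probability T R).
Implicit Types f g : T -> R.

(** A class closed under all the operations used below, on which expectations are finite and linear
    without further side conditions. *)
Definition bmeas f : Prop :=
  measurable_fun setT f /\ exists M, forall x, `|f x| <= M.

Lemma bmeas_cst (r : R) : bmeas (fun=> r).
Proof. by split; [exact: measurable_cst|exists `|r|]. Qed.

Lemma bmeasD f g : bmeas f -> bmeas g -> bmeas (fun x => f x + g x).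
Proof.
move=> [mf [M fM]] [mg [N gN]]; split; first exact: measurable_funD.
by exists (M + N) => x; apply: (le_trans (ler_normD _ _)); exact: lerD.
Qed.

Lemma bmeasM f g : bmeas f -> bmeas g -> bmeas (fun x => f x * g x).
Proof.
move=> [mf [M fM]] [mg [N gN]]; split; first exact: measurable_funM.
by exists (M * N) => x; rewrite normrM; exact: ler_pM.
Qed.

Lemma bmeasZ (r : R) f : bmeas f -> bmeas (fun x => r * f x).
Proof. exact/bmeasM/bmeas_cst. Qed.

Lemma bmeasB f g : bmeas f -> bmeas g -> bmeas (fun x => f x - g x).
Proof.
move=> bf bg; under eq_fun do rewrite -mulN1r.
exact/bmeasD/bmeasZ.
Qed.

Lemma bmeas_norm f : bmeas f -> bmeas (fun x => `|f x|).
Proof.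
move=> [mf [M fM]]; split; first exact: measurableT_comp.
by exists M => x; rewrite normr_id.
Qed.

Lemma bmeas_sum (I : Type) (s : seq I) (F : I -> T -> R) :
  (forall i, bmeas (F i)) -> bmeas (fun x => \sum_(i <- s) F i x).
Proof.
move=> bF; elim: s => [|i s ih].
  by under eq_fun do rewrite big_nil; exact: bmeas_cst.
by under eq_fun do rewrite big_cons; exact: bmeasD.
Qed.

Lemma bmeas_prod (I : Type) (s : seq I) (F : I -> T -> R) :
  (forall i, bmeas (F i)) -> bmeas (fun x => \prod_(i <- s) F i x).
Proof.
move=> bF; elim: s => [|i s ih].
  by under eq_fun do rewrite big_nil; exact: bmeas_cst.
by under eq_fun do rewrite big_cons; exact: bmeasM.
Qed.

Lemma bmeas_integrable f : bmeas f -> P.-integrable setT (EFin \o f).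
Proof.
move=> [mf [M fM]]; apply: measurable_bounded_integrable => //.
  by apply: le_lt_trans (ltry 1%R); exact: probability_le1.
exists M; split; first exact: num_real.
by move=> x Mx y _; exact: le_trans (fM y) (ltW Mx).
Qed.

Local Notation E f := (Rintegral P setT f).

Lemma bmeas_EFin f : bmeas f -> (\int[P]_x (f x)%:E)%E = (E f)%:E.
Proof.
move=> bf; rewrite /Rintegral fineK//.
apply: integrable_fin_num => //; exact: bmeas_integrable.
Qed.

Lemma ED f g : bmeas f -> bmeas g -> E (fun x => f x + g x) = E f + E g.
Proof. by move=> bf bg; rewrite RintegralD//; exact: bmeas_integrable. Qed.

Lemma EB f g : bmeas f -> bmeas g -> E (fun x => f x - g x) = E f - E g.
Proof. by move=> bf bg; rewrite RintegralB//; exact: bmeas_integrable. Qed.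

Lemma EZ (r : R) f : bmeas f -> E (fun x => r * f x) = r * E f.
Proof. by move=> bf; rewrite RintegralZl//; exact: bmeas_integrable. Qed.

Lemma Ecst (r : R) : E (fun=> r) = r.
Proof. by rewrite Rintegral_cst//= (@probability_setT _ _ _ P) mulr1. Qed.

Lemma Esum (I : Type) (s : seq I) (F : I -> T -> R) :
  (forall i, bmeas (F i)) ->
  E (fun x => \sum_(i <- s) F i x) = \sum_(i <- s) E (F i).
Proof.
move=> bF; elim: s => [|i s ih].
  by rewrite big_nil; under eq_Rintegral do rewrite big_nil; exact: Ecst.
rewrite big_cons -ih; under eq_Rintegral do rewrite big_cons.
by rewrite ED//; exact: bmeas_sum.
Qed.

Lemma le_E f g : bmeas f -> bmeas g -> (forall x, f x <= g x) -> E f <= E g.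
Proof. by move=> bf bg fg; apply: le_Rintegral => //;
  exact: bmeas_integrable. Qed.

Lemma cvg_E (F : nat -> T -> R) f (M : R) :
  (forall n, measurable_fun setT (F n)) -> measurable_fun setT f ->
  (forall n x, `|F n x| <= M) ->
  {ae P, forall x, F ^~ x @ \oo --> f x} -> E (F n) @[n --> \oo] --> E f.
Proof.
move=> mF mf FM Ff.
have bF n : bmeas (F n) by split=> //; exists M.
have [fi _ cF] : [/\ P.-integrable setT (EFin \o f),
    (fun n => \int[P]_x `|(F n x)%:E - (f x)%:E|)%E @ \oo --> 0%E &
    (fun n => \int[P]_x (F n x)%:E)%E @ \oo --> (\int[P]_x (f x)%:E)%E].
  apply: (@dominated_convergence _ _ _ P _ measurableT
    (fun n x => (F n x)%:E) (EFin \o f) (fun=> M%:E)).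
  - by move=> n; exact/measurable_EFinP.
  - exact/measurable_EFinP.
  - by apply: filterS Ff => x Fx _; apply: cvg_EFin => //; exact: nearW.
  - exact: (bmeas_integrable (bmeas_cst M)).
  - by apply: aeW => x n _; rewrite lee_fin.
have fin : (\int[P]_x (f x)%:E)%E \is a fin_num by exact: integrable_fin_num.
by apply: fine_cvg; rewrite /Rintegral fineK.
Qed.

Lemma E_eq0_ae f : bmeas f -> (forall x, 0 <= f x) -> E f = 0 ->
  {ae P, forall x, f x = 0}.
Proof.
move=> bf f0 Ef; have [mf _] := bf.
have mfE : measurable_fun setT (EFin \o f) by exact/measurable_EFinP.
have /(ae_eq_integral_abs P measurableT mfE) : (\int[P]_x `|(f x)%:E|)%E = 0%E.
  by under eq_integral do rewrite gee0_abs ?lee_fin//; rewrite bmeas_EFin// Ef.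
by apply: filterS => x /(_ I) [].
Qed.

End bounded_measurable.

(** * Finite permutations on initial segments *)

Section finperm_facts.

Lemma finperm_bound (s : finperm) : exists N, forall n, (N <= n)%N -> s n = n.
Proof.
have /finite_seqP[r rE] := fperm_fin s.
exists (\max_(i <- r) i.+1)%N => n Nn; apply/eqP; apply: contraLR Nn => sn.
have : [set` r] n by rewrite -rE.
move=> /= nr; rewrite -ltnNge.
exact: (@leq_bigmax_seq _ r predT (fun i => i.+1) n).
Qed.

Lemma finperm_iota (s : finperm) N : (forall n, (N <= n)%N -> s n = n) ->
  forall n, (N <= n)%N -> perm_eq (map s (iota 0 n)) (iota 0 n).
Proof.
move=> sN n Nn; have sI : injective s := bij_inj (fperm_bij s).
have us : uniq (map s (iota 0 n)) by rewrite map_inj_uniq// iota_uniq.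
have sub : {subset map s (iota 0 n) <= iota 0 n}.
  move=> k /mapP[i]; rewrite mem_iota /= add0n => ni ->;
    rewrite mem_iota /= add0n.
  (* A value [s i] beyond [n] would be a fixed point of [s], hence equal to [i] by injectivity,
     although [i] is below [n]. *)
  rewrite ltnNge; apply/negP => nsi.
  have : s (s i) = s i by apply: sN; exact: leq_trans Nn nsi.
  by move=> /sI si; move: nsi; rewrite si leqNgt ni.
have [_ e] := uniq_min_size us sub (eq_leq (esym (size_map s (iota 0 n)))).
by apply: uniq_perm; rewrite ?iota_uniq.
Qed.

Lemma finperm_big (T : Type) (idx : T) (op : Monoid.com_law idx)
    (s : finperm) N :
  (forall n, (N <= n)%N -> s n = n) -> forall n (F : nat -> T), (N <= n)%N ->
  \big[op/idx]_(i < n) F (s i) = \big[op/idx]_(i < n) F i.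
Proof.
move=> sN n F Nn; rewrite -!(big_mkord predT) /index_iota subn0.
rewrite -(perm_big _ (finperm_iota sN Nn)) big_map.
by rewrite -(big_mkord predT (fun i => F (s i))) /index_iota subn0.
Qed.

Definition swapn (i j n : nat) : nat :=
  if n == i then j else if n == j then i else n.

Lemma swapnK i j : involutive (swapn i j).
Proof.
move=> n; rewrite /swapn; have [->|ni] := eqVneq n i.
  by have [->|] := eqVneq j i; rewrite ?eqxx.
by have [->|nj] := eqVneq n j; rewrite ?eqxx// (negbTE ni) (negbTE nj).
Qed.

Definition swap (i j : nat) : finperm.
Proof.
exists (swapn i j); first exact: inv_bij (swapnK i j).
apply: (@sub_finite_set _ _ [set i; j]) => // n /=; rewrite /swapn.
by have [->|ni] := eqVneq n i; [left|have [->|] := eqVneq n j;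
  [right|rewrite eqxx]].
Defined.

Lemma swapE i j n : swap i j n = swapn i j n. Proof. by []. Qed.

Lemma swapl i j : swap i j i = j.
Proof. by rewrite swapE /swapn eqxx. Qed.

Lemma swap_neq i j n : n != i -> n != j -> swap i j n = n.
Proof. by rewrite swapE /swapn => /negbTE -> /negbTE ->. Qed.

End finperm_facts.

(** * Frequencies and their invariance *)

Section frequencies.
Local Open Scope ring_scope.
Context d (X : measurableType d) (R : realType).
Local Notation XN := (ipower X).
Implicit Types (A : set X) (x : XN).

(** The action without the inverse, so that a coordinate of the shuffled sequence is read directly;
    exchangeability quantifies over all permutations and does not see the difference. *)
Definition shuffle (s : finperm) x : XN := fun k => x (s k).

Lemma shuffleE s : shuffle s = permute (s^-1)%g.
Proof. by apply/funext => x; apply/funext => k; rewrite /permute invgK. Qed.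

Definition hit A i x : R := \1_A (x i).

Definition freq A n x : R := n%:R^-1 * \sum_(i < n) hit A i x.

(* Convergence of the frequencies is only shown along the powers of 4; the
   clamping makes the values bounded where it fails. *)
Definition lim_freq A x : R :=
  Num.max 0 (Num.min 1 (limn_sup (fun k => freq A (4 ^ k)%N x))).

Lemma bmeas_hit A i : measurable A -> bmeas (hit A i).
Proof.
move=> mA; split.
  have mI : measurable_fun setT (\1_A : X -> R) by exact: measurable_indic.
  exact: (measurableT_comp mI (measurable_icoord i)).
by exists 1 => x; rewrite /hit indicE; case: (_ \in _); rewrite ?normr0 ?normr1.
Qed.

Lemma hit_ge0 A i x : 0 <= hit A i x.
Proof. by rewrite /hit indicE. Qed.

Lemma hit_le1 A i x : hit A i x <= 1.
Proof. by rewrite /hit indicE; case: (_ \in _). Qed.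

Lemma freq_ge0 A n x : 0 <= freq A n x.
Proof. by rewrite mulr_ge0 ?invr_ge0// sumr_ge0// => i _; exact: hit_ge0. Qed.

Lemma freq_le1 A n x : freq A n x <= 1.
Proof.
rewrite /freq; case: n => [|n]; first by rewrite invr0 mul0r.
rewrite mulrC ler_pdivrMr// mul1r.
rewrite -[leRHS](_ : \sum_(i < n.+1) 1 = _);
  last by rewrite sumr_const card_ord.
by apply: ler_sum => i _; exact: hit_le1.
Qed.

Lemma measurable_freq A n : measurable A -> measurable_fun setT (freq A n).
Proof.
move=> mA; have [] // : bmeas (freq A n).
by apply: bmeasZ; apply: bmeas_sum => i; exact: bmeas_hit.
Qed.

Lemma bmeas_freq A n : measurable A -> bmeas (freq A n).
Proof.
move=> mA; split; first exact: measurable_freq.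
by exists 1 => x; rewrite ger0_norm ?freq_le1 ?freq_ge0.
Qed.

Lemma lim_freq_ge0 A x : 0 <= lim_freq A x.
Proof. by rewrite /lim_freq le_max lexx. Qed.

Lemma lim_freq_le1 A x : lim_freq A x <= 1.
Proof. by rewrite /lim_freq ge_max ler01/= ge_min lexx. Qed.

Lemma bmeas_lim_freq A : measurable A -> bmeas (lim_freq A).
Proof.
move=> mA; split; last first.
  by exists 1 => x; rewrite ger0_norm ?lim_freq_le1 ?lim_freq_ge0.
apply: measurable_maxr => //; apply: measurable_minr => //.
apply: measurable_fun_limn_sup => [x _|x _|k].
- by exists 1 => _ [k _ <-]; exact: freq_le1.
- by exists 0 => _ [k _ <-]; exact: freq_ge0.
- exact: measurable_freq.
Qed.

Lemma lim_freq_cvg A x : cvgn (fun k => freq A (4 ^ k)%N x) ->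
  freq A (4 ^ k)%N x @[k --> \oo] --> lim_freq A x.
Proof.
move=> cf; suff -> : lim_freq A x = limn (fun k => freq A (4 ^ k)%N x) by [].
rewrite /lim_freq cvg_limn_supE// min_r ?max_r//.
- by apply: limr_ge => //; apply: nearW => k; exact: freq_ge0.
- by apply: limr_le => //; apply: nearW => k; exact: freq_le1.
Qed.

Lemma limn_sup_near (u v : nat -> R) N :
  (forall n, (N <= n)%N -> u n = v n) -> limn_sup u = limn_sup v.
Proof.
move=> uv; have E n : (N <= n)%N -> sups u n = sups v n.
  move=> Nn; rewrite /sups; congr sup; apply/seteqP.
  by split=> _ [k nk <-]; exists k => //; rewrite uv//; exact: leq_trans Nn nk.
rewrite /limn_sup; congr (lim _); apply/seteqP; split; apply: near_eq_cvg;
  by exists N => // n Nn; rewrite E.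
Qed.

(** From some rank on [s] only permutes the first [4 ^ n] places and leaves the frequency unchanged.
    The upper limit exists everywhere, so the equality holds at every point and not just almost
    surely. *)
Lemma lim_freq_shuffle A s x : lim_freq A (shuffle s x) = lim_freq A x.
Proof.
have [N sN] := finperm_bound s.
rewrite /lim_freq (@limn_sup_near _ (fun k => freq A (4 ^ k)%N x) N)// => n Nn.
rewrite /freq; congr (_ * _).
transitivity (\sum_(i < 4 ^ n) hit A (s i) x) => //.
apply: (@finperm_big _ _ (GRing.add : Monoid.com_law 0) s N sN _ (fun i =>
  hit A i x)).
exact: leq_trans Nn (ltnW (ltn_expl _ _)).
Qed.

End frequencies.
Arguments hit {d X R}.
Arguments freq {d X R}.
Arguments lim_freq {d X R}.

(** * Second moments and almost sure convergence *)

Section exchangeable_frequencies.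
Local Open Scope ring_scope.
Context d (X : measurableType d) (R : realType) (p : probability (ipower X) R).
Hypothesis hp : exchangeable p.
Local Notation XN := (ipower X).
Local Notation E f := (Rintegral p setT f).
Implicit Types (A : set X) (x : XN).

Lemma E_shuffle (s : finperm) (f : XN -> R) : bmeas f ->
  E (fun x => f (shuffle s x)) = E f.
Proof.
move=> bf; have ms := @measurable_permute _ X (s^-1)%g.
have [mf [M fM]] := bf.
have mfE : measurable_fun setT (EFin \o f) by exact/measurable_EFinP.
have bfs : bmeas (f \o permute (s^-1)%g).
  by split; [exact: measurableT_comp|exists M => x; exact: fM].
rewrite /Rintegral shuffleE; congr fine.
rewrite -(integral_pushforward ms mfE (bmeas_integrable p bfs) measurableT).
by apply: eq_measure_integral => B mB _; exact: hp.
Qed.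

Section one_set.
Variables (A : set X) (mA : measurable A).
Local Notation a := (E (hit A 0)).
Local Notation b := (E (fun x => hit A 0 x * hit A 1 x)).

Let bh i : bmeas (hit (R := R) A i) . Proof. exact: bmeas_hit. Qed.
Let bf n : bmeas (freq (R := R) A n) . Proof. exact: bmeas_freq. Qed.

Lemma E_hit i : E (hit A i) = a.
Proof.
rewrite -(E_shuffle (swap 0 i) (bh 0)); apply: eq_Rintegral => x _.
by rewrite /hit /shuffle swapl.
Qed.

Lemma E_hit_hit i j :
  E (fun x => hit A i x * hit A j x) = if i == j then a else b.
Proof.
have [->|ij] := eqVneq i j.
  rewrite -(E_hit j); apply: eq_Rintegral => x _.
  by rewrite /hit indicE; case: (_ \in _); rewrite ?mulr0 ?mulr1.
(* The place that [swap 0 i] sends to [j]. It differs from 0, so first exchanging 1 with [j'] leaves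
   0 fixed, and the composite sends 0 to [i] and 1 to [j]. *)
pose j' := swap 0 i j.
have j'0 : 0%N != j'.
  apply/eqP => h; have := swapnK 0 i j; rewrite -!swapE -/j' -h swapl => ji.
  by rewrite ji eqxx in ij.
pose s : finperm := (swap 0 i * swap 1 j')%g.
have s0 : s 0%N = i by rewrite -[s 0%N]/(swap 0 i (swap 1 j' 0)) (@swap_neq 1
  j')// swapl.
have s1 : s 1%N = j.
  by rewrite -[s 1%N]/(swap 0 i (swap 1 j' 1)) swapl /j' !swapE swapnK.
rewrite -(E_shuffle s (bmeasM (bh 0) (bh 1))); apply: eq_Rintegral => x _.
by rewrite /hit /shuffle s0 s1.
Qed.

(** Each of the [n] rows of the double sum has [m] entries, exactly one of them diagonal because
    [n <= m]. The average therefore depends on the larger index only, which is what makes the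
    squared distance collapse. *)
Lemma E_freq_freq n m : (0 < n <= m)%N ->
  E (fun x => freq A n x * freq A m x) = b + (a - b) / m%:R.
Proof.
move=> /andP[n0 nm]; have m0 := leq_trans n0 nm.
have n0' : n%:R != 0 :> R by rewrite pnatr_eq0 -lt0n.
have m0' : m%:R != 0 :> R by rewrite pnatr_eq0 -lt0n.
transitivity (E (fun x => (n%:R^-1 * m%:R^-1) *
    \sum_(i < n) \sum_(j < m) hit A i x * hit A j x)).
  apply: eq_Rintegral => x _; rewrite /freq mulrACA; congr (_ * _).
  by rewrite big_distrlr.
rewrite EZ; last by do 2 (apply: bmeas_sum => ?); exact: bmeasM.
rewrite Esum; last by move=> i; apply: bmeas_sum => j; exact: bmeasM.
have Ei (i : 'I_n) : E (fun x => \sum_(j < m) hit A i x * hit A j x)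
  = m%:R * b + (a - b).
  rewrite Esum; last by move=> j; exact: bmeasM.
  under eq_bigr do rewrite E_hit_hit.
  have im : (i < m)%N by exact: leq_trans nm.
  transitivity (\sum_(j < m) (b + if j == Ordinal im then a - b else 0)).
    by apply: eq_bigr => j _; rewrite -val_eqE/= eq_sym; case: eqP => _; ring.
  by rewrite big_split/= sumr_const card_ord mulr_natl -big_mkcond big_pred1_eq.
under eq_bigr do rewrite Ei.
by rewrite sumr_const card_ord -mulr_natl; field; rewrite n0' m0'.
Qed.

Let ab01 : 0 <= a - b <= 1.
Proof.
have h0 := @hit_ge0 _ X R; have h1 := @hit_le1 _ X R.
apply/andP; split.
  rewrite subr_ge0; apply: le_E => [|//|x]; first exact: bmeasM.
  by rewrite ler_piMr.
have : a <= E (cst 1) by apply: le_E => //; exact: bmeas_cst.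
rewrite Ecst => a1; suff : 0 <= b by lra.
by apply: Rintegral_ge0 => x _; exact: mulr_ge0.
Qed.

Lemma E_freq_dist n m (c : R) : (0 < n <= m)%N -> 0 < c ->
  E (fun x => `|freq A m x - freq A n x|) <= (c / n%:R + c^-1) / 2.
Proof.
move=> nm c0; have [n0 nm'] := andP nm; have m0 := leq_trans n0 nm'.
have bD : bmeas (fun x => freq (R := R) A m x - freq A n x) by exact: bmeasB.
have bD2 := bmeasM bD bD.
have ED2 : E (fun x => (freq A m x - freq A n x) * (freq A m x - freq A n x))
    <= n%:R^-1.
  have -> : E (fun x => (freq A m x - freq A n x) * (freq A m x - freq A n x)) =
      E (fun x => freq A m x * freq A m x) + E (fun x =>
        freq A n x * freq A n x)
      - 2 * E (fun x => freq A n x * freq A m x).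
    rewrite -EZ; last exact: bmeasM.
    rewrite -ED; try exact: bmeasM.
    rewrite -EB; [|by apply: bmeasD; exact: bmeasM|by apply: bmeasZ;
      exact: bmeasM].
    by apply: eq_Rintegral => x _; ring.
  rewrite !E_freq_freq ?n0 ?m0 ?leqnn//.
  have n0' : 0 < n%:R^-1 :> R by rewrite invr_gt0 ltr0n.
  have m0' : 0 < m%:R^-1 :> R by rewrite invr_gt0 ltr0n.
  by have := ab01; set u := a - b => /andP[u0 u1]; nra.
(* In place of Cauchy-Schwarz, the pointwise bound of the absolute value of D by half of c times D
   squared plus the inverse of c; the gap is a square. The parameter [c] is left free to be
   tuned. *)
have : E (fun x => `|freq A m x - freq A n x|) <=
    E (fun x => c / 2 * ((freq A m x - freq A n x) * (freq A m x - freq A n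
      x)) + c^-1 / 2).
  apply: le_E => [|//|x]; first exact: bmeas_norm.
    by apply: bmeasD; [exact: bmeasZ|exact: bmeas_cst].
  set D := freq A m x - freq A n x.
  have -> : D * D = `|D| ^+ 2 by rewrite -normrX ger0_norm ?sqr_ge0.
  rewrite -subr_ge0 (_ : _ - _ = (c * `|D| - 1) ^+ 2 * (c^-1 / 2)).
    by rewrite mulr_ge0 ?sqr_ge0// divr_ge0// invr_ge0 ltW.
  by field; rewrite gt_eqF.
rewrite ED; [|exact: bmeasZ|exact: bmeas_cst].
rewrite EZ// Ecst => /le_trans; apply; rewrite mulrDl lerD2r.
by rewrite mulrAC ler_wpM2r ?invr_ge0// ler_wpM2l// ltW.
Qed.

Lemma ae_freq_cvg :
  {ae p, forall x, (freq A (4 ^ k)%N x : R) @[k --> \oo] --> lim_freq A x}.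
Proof.
pose D k x := freq A (4 ^ k.+1)%N x - freq A (4 ^ k)%N x : R.
have bD k : bmeas (D k) by exact: bmeasB.
have ED k : E (fun x => `|D k x|) <= 2 / (2 ^ k.+1)%:R.
  (* At [n = 4 ^ k] the value [c = 2 ^ k] balances the two terms of the bound, each being the
     inverse of [2 ^ k]. The result is written with [k.+1] to match the geometric series summed
     below. *)
  have c0 : 0 < 2 ^+ k :> R by rewrite exprn_gt0.
  have := @E_freq_dist (4 ^ k)%N (4 ^ k.+1)%N _ _ c0.
  rewrite expn_gt0/= leq_exp2l// leqnSn => /(_ isT) /le_trans; apply.
  rewrite !natrX exprS (_ : 4 = 2 * 2 :> R) ?exprMn; last by ring.
  by rewrite le_eqVlt; apply/orP; left; apply/eqP; field; rewrite gt_eqF.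
have mD k : measurable_fun setT (fun x => `|D k x|%:E).
  by apply/measurable_EFinP; have [] := bmeas_norm (bD k).
have intD : p.-integrable setT (fun x => \sum_(k <oo) `|D k x|%:E)%E.
  apply/integrableP; split.
    by apply: ge0_emeasurable_sum => // k x _ _; rewrite lee_fin.
  under eq_integral.
    move=> x _; rewrite gee0_abs; last by apply: nneseries_ge0 => k _ _;
      rewrite lee_fin.
    over.
  rewrite integral_nneseries//.
  apply: (@le_lt_trans _ _ (\sum_(k <oo) (2 / (2 ^ k.+1)%:R)%:E)%E).
    apply: lee_nneseries => [k _ _|k _].
      by apply: integral_ge0 => x _; rewrite lee_fin.
    by rewrite bmeas_EFin ?lee_fin//; exact: bmeas_norm.
  by apply: le_lt_trans (epsilon_trick0 _ _) (ltry 2).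
(* The sum of the absolute increments has finite expectation, so it is finite almost surely and the
   telescoping series converges absolutely. *)
have := integrable_ae measurableT intD; apply: filterS => x /(_ I) finx.
apply: lim_freq_cvg.
suff cD : cvgn (series (D ^~ x)).
  apply/cvg_ex; exists (freq A 1 x + limn (series (D ^~ x))).
  rewrite (_ : (fun k => _) = fun k => freq A 1 x + series (D ^~ x) k).
    by apply: cvgD => //; exact: cvg_cst.
  apply/funext => k; rewrite (eq_sum_telescope (fun k => freq A (4 ^ k)%N x) k).
  by rewrite expn0.
apply: normed_cvg; apply: nondecreasing_is_cvgn.
  apply/nondecreasing_seqP => n; rewrite /= !seriesEnat /= big_nat_recr//=.
  by rewrite lerDl.
exists (fine (\sum_(k <oo) `|D k x|%:E)%E) => _ [n _ <-].
rewrite -lee_fin fineK// /= seriesEnat /= -sumEFin.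
by apply: nneseries_lim_ge => k _; rewrite lee_fin.
Qed.

End one_set.
End exchangeable_frequencies.

(** * Joint moments of the limiting frequencies *)

Section exchangeable_moments.
Local Open Scope ring_scope.
Context d (X : measurableType d) (R : realType) (p : probability (ipower X) R).
Hypothesis hp : exchangeable p.
Local Notation XN := (ipower X).
Local Notation E f := (Rintegral p setT f).
Implicit Types (A : set X) (x : XN).

(* By exchangeability hit A j may be replaced by hit A l for every l >= j, hence
   by the average of these, which converges to lim_freq A. *)
Lemma E_hit_lim_freq A j (W : XN -> R) : measurable A -> bmeas W ->
  (forall l x, (j <= l)%N -> W (shuffle (swap j l) x) = W x) ->
  E (fun x => W x * hit A j x) = E (fun x => W x * lim_freq A x).
Proof.
move=> mA bW Wj; pose e l := E (fun x => W x * hit A l x).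
have bh l : bmeas (hit (R := R) A l) by exact: bmeas_hit.
have ej l : (j <= l)%N -> e l = e j.
  move=> jl; rewrite /e -(E_shuffle hp (swap j l) (bmeasM bW (bh j))).
  by apply: eq_Rintegral => x _; rewrite Wj// /hit /shuffle swapl.
(* The finitely many places before [j] cannot be exchanged with it; their total defect is constant
   and disappears after division by [n]. *)
pose c := \sum_(0 <= l < j) (e l - e j).
have Efreq n : (0 < n)%N -> (j <= n)%N ->
    E (fun x => W x * freq A n x) = e j + n%:R^-1 * c.
  move=> n0 jn.
  transitivity (E (fun x => n%:R^-1 * \sum_(l < n) W x * hit A l x)).
    by apply: eq_Rintegral => x _; rewrite /freq mulrCA mulr_sumr.
  rewrite EZ; last by apply: bmeas_sum => l; exact: bmeasM.
  rewrite Esum; last by move=> l; exact: bmeasM.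
  rewrite -(big_mkord predT e).
  have -> : \sum_(0 <= l < n) e l = \sum_(0 <= l < n) (e l - e j) + n%:R * e j.
    by rewrite sumrB sumr_const_nat subn0 mulr_natl subrK.
  have e0 : \sum_(j <= l < n) (e l - e j) = 0.
    by rewrite big_nat big1// => l /andP[jl _]; rewrite ej// subrr.
  rewrite (big_cat_nat _ jn)//= e0 addr0.
  by rewrite mulrDr mulKf ?pnatr_eq0 -?lt0n// addrC.
have [mW [M WM]] := bW.
have cv : E (fun x => W x * freq A (4 ^ k)%N x) @[k --> \oo] -->
    E (fun x => W x * lim_freq A x).
  apply: (@cvg_E _ _ _ p _ _ M).
  - by move=> n; apply: measurable_funM => //; exact: measurable_freq.
  - by apply: measurable_funM => //; have [] := @bmeas_lim_freq _ X R _ mA.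
  - move=> n x; rewrite normrM -[leRHS]mulr1 ler_pM//.
    by rewrite ger0_norm ?freq_le1 ?freq_ge0.
  - by apply: filterS (ae_freq_cvg hp mA) => x; exact: cvgMr.
have cj : E (fun x => W x * freq A (4 ^ k)%N x) @[k --> \oo] --> e j.
  have : (e j + (4^-1 ^+ k) * c) @[k --> \oo] --> e j + 0 * c.
    apply: cvgD; first exact: cvg_cst.
    by apply: cvgMl; apply: cvg_expr; rewrite ger0_norm// invf_lt1// ltr1n.
  rewrite mul0r addr0; apply: cvg_trans; apply: near_eq_cvg.
  exists j => // k /= jk; rewrite Efreq ?expn_gt0//;
    first by rewrite natrX exprVn.
  by apply: (leq_trans jk); exact/ltnW/ltn_expl.
by apply: (cvg_unique _ cj cv); exact: Rhausdorff.
Qed.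

(** The factors are replaced one at a time, starting from the last. While place [j] is treated, the
    other factors are unchanged by exchanging [j] with a later place: the hits only look at places
    before [j], and limiting frequencies are invariant. *)
Lemma E_prod_hit (B : nat -> set X) k : (forall i, measurable (B i)) ->
  E (fun x => \prod_(0 <= i < k) hit (B i) i x) =
  E (fun x => \prod_(0 <= i < k) lim_freq (B i) x).
Proof.
move=> mB.
pose H j := E (fun x => \prod_(0 <= i < j) hit (B i) i x *
                        \prod_(j <= i < k) lim_freq (B i) x).
suff h j : (j <= k)%N -> H j = H 0%N.
  transitivity (H k).
    by apply: eq_Rintegral => x _; rewrite [X in _ * X]big_geq ?mulr1.
  by rewrite h//; apply: eq_Rintegral => x _;
    rewrite [X in X * _]big_geq ?mul1r.
elim: j => [//|j ih] jk; rewrite -ih; last exact: ltnW.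
pose W x : R := \prod_(0 <= i < j) hit (B i) i x *
                \prod_(j.+1 <= i < k) lim_freq (B i) x.
transitivity (E (fun x => W x * hit (B j) j x)).
  apply: eq_Rintegral => x _; rewrite /W big_nat_recr//= -!mulrA; congr (_ * _).
  by rewrite mulrC.
rewrite (@E_hit_lim_freq (B j) j W)//.
- apply: eq_Rintegral => x _; rewrite /W [in RHS](big_ltn jk) -!mulrA.
  by congr (_ * _); rewrite mulrC.
- apply: bmeasM; apply: bmeas_prod => i; first exact: bmeas_hit.
  exact: bmeas_lim_freq.
- move=> l x jl; rewrite /W; congr (_ * _).
    apply: eq_big_nat => i /andP[_ ij]; rewrite /hit /shuffle swap_neq//.
      by rewrite ltn_eqF.
    by rewrite ltn_eqF// (leq_trans ij).
  by apply: eq_big_nat => i _; rewrite lim_freq_shuffle.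
Qed.

Lemma exchangeable_rect (B : nat -> set X) k : (forall i, measurable (B i)) ->
  p [set x | forall i, (i < k)%N -> B i (x i)] =
  (\int[p]_x (\prod_(0 <= i < k) lim_freq (B i) x)%:E)%E.
Proof.
move=> mB; rewrite bmeas_EFin; last first.
  by apply: bmeas_prod => i; exact: bmeas_lim_freq.
rewrite -E_prod_hit// -bmeas_EFin; last first.
  by apply: bmeas_prod => i; exact: bmeas_hit.
have [mr _] := cylinder_rect k mB.
set S := mkset _; transitivity (\int[p]_x (\1_S x)%:E)%E.
  by rewrite integral_indic// setIT.
apply: eq_integral => x _; congr EFin; rewrite indicE big_mkord.
have [xB|xB] := boolP (x \in _).
  rewrite big1// => i _; rewrite /hit indicE mem_set//.
  by move/set_mem: xB; exact.
apply/esym/eqP; rewrite prodf_seq_eq0.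
apply: contraR xB => /hasPn h; apply/mem_set => i ik.
have /= := h (Ordinal ik) (mem_index_enum _); rewrite /hit indicE.
by have [/set_mem|] := boolP (x i \in B i); rewrite ?eqxx.
Qed.

End exchangeable_moments.

(** * Directing measures *)

Section mixture.
Import HBNNSimple.
Context d d' (Y : measurableType d) (Z : measurableType d') (R : realType).
Variables (q : probability Y R) (w : Y -> R) (k : R.-pker Y ~> Z).
Hypothesis mw : measurable_fun setT w.
Hypothesis w0 : forall y, (0 <= w y)%R.

Let mwk B : measurable B -> measurable_fun setT (fun y => (w y)%:E * k y B).
Proof.
move=> mB; apply: emeasurable_funM; first exact/measurable_EFinP.
exact: measurable_kernel.
Qed.

Let we0 y : 0 <= (w y)%:E. Proof. by rewrite lee_fin. Qed.

Let mwe : measurable_fun setT (fun y => (w y)%:E). Proof.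
  exact/measurable_EFinP. Qed.

Let mix (B : set Z) : \bar R := \int[q]_y ((w y)%:E * k y B).

Let mix0 : mix set0 = 0.
Proof. by apply: integral0_eq => y _; rewrite measure0 mule0. Qed.

Let mix_ge0 B : 0 <= mix B.
Proof. by apply: integral_ge0 => y _; exact: mule_ge0. Qed.

Let mix_sigma_additive : semi_sigma_additive mix.
Proof.
move=> U mU tU mUU; rewrite [X in _ --> X](_ : _ =
    \int[q]_y (\sum_(n <oo) (w y)%:E * k y (U n))); last first.
  apply: eq_integral => y _; rewrite nneseriesZl; last by move=> n _.
  congr (_ * _); apply/esym/cvg_lim => //.
  exact/measure_semi_sigma_additive.
apply/cvg_closeP; split.
  by apply: is_cvg_nneseries => n _ _; exact: mix_ge0.
rewrite closeE// integral_nneseries//.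
  by move=> n; exact: mwk.
by move=> n y _; exact: mule_ge0.
Qed.

HB.instance Definition _ := isMeasure.Build _ _ _ mix
  mix0 mix_ge0 mix_sigma_additive.

Hypothesis w1 : \int[q]_y (w y)%:E = 1.

Let mixT : mix setT = 1.
Proof. by rewrite /mix; under eq_integral do rewrite prob_kernel mule1. Qed.

HB.instance Definition _ := Measure_isProbability.Build _ _ _ mix mixT.

(** Used with constant weight 1 to average the i.i.d. laws of random measures, and with the
    normalised indicator of an event to condition a cone on that event. *)
Definition mixture : probability Z R := mix.

Lemma mixtureE B : mixture B = \int[q]_y ((w y)%:E * k y B). Proof. by []. Qed.

Let integral_mixture_nnsfun (h : {nnsfun Z >-> R}) :
  \int[mixture]_z (h z)%:E = \int[q]_y ((w y)%:E * \int[k y]_z (h z)%:E).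
Proof.
rewrite integralT_nnsfun sintegralE.
under [RHS]eq_integral do rewrite integralT_nnsfun sintegralE.
have mk r : measurable_fun setT (fun y => k y (h @^-1` [set r])).
  by apply: measurable_kernel; exact: measurable_sfunP.
(* The sum over values ranges over all reals; a negative [r] contributes nothing, its preimage under
   the nonnegative [h] being empty. *)
have hk0 y (r : R) : 0 <= r%:E * k y (h @^-1` [set r]).
  have [r0|r0] := leP 0%R r; first by rewrite mule_ge0.
  by rewrite preimage_nnfun0// measure0 mule0.
under [RHS]eq_integral do rewrite ge0_mule_fsumr//.
rewrite ge0_integral_fsum//.
- apply: eq_fsbigr => r _.
  under [RHS]eq_integral do rewrite muleCA.
  have [r0|r0] := leP 0%R r.
    rewrite ge0_integralZl//; first by apply: mwk; exact: measurable_sfunP.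
    by move=> y _; exact: mule_ge0.
  rewrite preimage_nnfun0// (measure0 mixture) mule0.
  by under eq_integral do rewrite measure0 !mule0; rewrite integral0.
- by move=> r; apply: emeasurable_funM => //; exact: emeasurable_funM.
- by move=> r y _; exact: mule_ge0.
Qed.

Lemma integral_mixture (f : Z -> \bar R) : measurable_fun setT f ->
  (forall z, 0 <= f z) ->
  \int[mixture]_z f z = \int[q]_y ((w y)%:E * \int[k y]_z f z).
Proof.
move=> mf f0; pose g := nnsfun_approx measurableT mf.
have gf z : (g n z)%:E @[n --> \oo] --> f z by exact: cvg_nnsfun_approx.
have ndg z : {homo (fun n => (g n z)%:E) : a b / (a <= b)%N >-> a <= b}.
  by move=> a b ab; rewrite lee_fin; exact/lefP/nd_nnsfun_approx.
have mg n : measurable_fun setT (fun z => (g n z)%:E) by exact/measurable_EFinP.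
have g0 n z : 0 <= (g n z)%:E by rewrite lee_fin.
have lim_int (m : {measure set Z -> \bar R}) :
    \int[m]_z f z = limn (fun n => \int[m]_z (g n z)%:E).
  rewrite -monotone_convergence//.
  by apply: eq_integral => z _; apply/esym/cvg_lim.
have mi n : measurable_fun setT (fun y => \int[k y]_z (g n z)%:E).
  apply: measurable_fun_integral_kernel => //; exact: measurable_kernel.
have i0 n y : 0 <= \int[k y]_z (g n z)%:E by exact: integral_ge0.
have ndi y : {homo (fun n =>
  \int[k y]_z (g n z)%:E) : a b / (a <= b)%N >-> a <= b}.
  by move=> a b ab; apply: ge0_le_integral => // z _; exact: ndg.
rewrite lim_int.
transitivity (limn (fun n => \int[q]_y ((w y)%:E * \int[k y]_z (g n z)%:E))).
  by congr (limn _); apply/funext => n; exact: integral_mixture_nnsfun.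
rewrite -monotone_convergence//.
- apply: eq_integral => y _; rewrite lim_int; apply: cvg_lim => //.
  apply: cvgeZl => //; apply: ereal_nondecreasing_is_cvgn.
  exact: ndi.
- by move=> n; exact: emeasurable_funM.
- by move=> n y _; exact: mule_ge0.
- by move=> y _ a b ab; apply: lee_wpmul2l => //; exact: ndi.
Qed.

End mixture.

Section rectangles.
Context d (X : measurableType d) (G : set (set X)).

(** The sides are confined to a generating family because the values of the directing measure are
    controlled, outside one null set, on countably many sets only. *)
Definition rects_of : set (set (ipower X)) :=
  [set A | exists n B, (forall i, G (B i)) /\
                       A = [set x | forall i, (i < n)%N -> B i (x i)]].

Lemma rects_ofI : setI_closed G -> G setT -> setI_closed rects_of.
Proof.
move=> GI GT _ _ [m [B [mB ->]]] [n [C [mC ->]]].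
exists (maxn m n), (fun i => (if (i < m)%N then B i else setT) `&`
                             (if (i < n)%N then C i else setT)); split.
  by move=> i; apply: GI; case: ifP.
apply/seteqP; split => x /=.
  by move=> [Bx Cx] i _; split; case: ifP => // ii; [exact: Bx|exact: Cx].
move=> h; split => i ii.
  by have [] := h i (leq_trans ii (leq_maxl _ _)); rewrite ii.
by have [] := h i (leq_trans ii (leq_maxr _ _)); rewrite ii.
Qed.

Lemma rects_ofT : G setT -> rects_of setT.
Proof. by move=> GT; exists 0%N, (fun=> setT); split=> //; apply/seteqP;
  split. Qed.

Lemma rects_of_gen : G setT -> @measurable _ X = <<s G>> ->
  @measurable _ (ipower X) = <<s rects_of >>.
Proof.
move=> GT GX; have mG A : G A -> measurable A.
  by move=> GA; rewrite GX; exact: sub_sigma_algebra.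
apply/seteqP; split; last first.
  apply: smallest_sub; first exact: sigma_algebra_measurable.
  move=> _ [n [B [GB ->]]].
  by have [] := @cylinder_rect _ X n B (fun i => mG _ (GB i)).
apply: smallest_sub; first exact: smallest_sigma_algebra.
move=> _ [i _ [B mB <-]]; rewrite setTI.
pose H : set (set X) := [set B | <<s rects_of >> ((fun x : ipower X =>
  x i) @^-1` B)].
suff : <<s G >> `<=` H by apply; rewrite -GX.
apply: smallest_sub.
  split.
  - by rewrite /H/= preimage_set0; exact: sigma_algebra0.
  - by move=> C HC; rewrite /H/= setTD preimage_setC; exact: sigma_algebraC.
  - by move=> F HF; rewrite /H/= preimage_bigcup; exact: sigma_algebra_bigcup.
move=> C GC; apply: sub_sigma_algebra.
exists i.+1, (fun j => if j == i then C else setT); split; first by move=> j;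
  case: ifP.
apply/seteqP; split => x /=; first by move=> Cx j _; case: eqP => // ->.
by move=> /(_ i (ltnSn i)); rewrite eqxx.
Qed.

End rectangles.

Section pmap.
Context d d' (X : measurableType d) (Y : measurableType d') (R : realType).
Variables (f : X -> Y) (mf : measurable_fun setT f).

Definition pmap (r : pspace X R) : pspace Y R := pspace_of (image_prob mf r).

Lemma pmapE r B : measurable B -> pmap r B = r (f @^-1` B).
Proof. by move=> mB; rewrite pspace_ofE. Qed.

Lemma measurable_pmap : measurable_fun setT pmap.
Proof.
apply: measurable_fun_pspace => B mB; under eq_fun do rewrite pmapE//.
apply: (measurable_pspace_ev (A := f @^-1` B)).
by have := mf measurableT mB; rewrite setTI.
Qed.

Definition imap (x : ipower X) : ipower Y := fun i => f (x i).

Lemma measurable_imap : measurable_fun setT imap.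
Proof.
by apply: measurable_fun_ipower => i;
  exact: (measurableT_comp mf (measurable_icoord i)).
Qed.

Lemma infinite_product_pmap (r : pspace X R) B : measurable B ->
  infinite_product (fun=> pmap r) B = infinite_product (fun=> r) (imap @^-1` B).
Proof.
move=> mB; apply/esym; apply: (infinite_product_unique
  (P := image_prob measurable_imap (infinite_product (fun=> r)))) => //.
move=> n C mC; rewrite image_probE.
have mfC i : measurable (f @^-1` C i) by have := mf measurableT (mC i);
  rewrite setTI.
rewrite (infinite_productE _ n mfC).
by apply: eq_bigr => i _; rewrite -pmapE.
Qed.

Lemma exchangeable_imap (p : probability (ipower X) R) :
  exchangeable p -> exchangeable (image_prob measurable_imap p).
Proof.
move=> hp s B mB; apply: (hp s (imap @^-1` B)).
by have := measurable_imap measurableT mB; rewrite setTI.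
Qed.

End pmap.

Section exchangeable_product.
Context d (X : measurableType d) (R : realType).

Lemma finperm_lt (s : finperm) N n : (forall i, (N <= i)%N -> s i = i) ->
  (N <= n)%N -> forall i, (i < n)%N -> (s i < n)%N.
Proof.
move=> sN Nn i ni; have /perm_mem/(_ (s i)) := finperm_iota sN Nn.
by rewrite (mem_map (bij_inj (fperm_bij s))) !mem_iota/= !add0n ni => <-.
Qed.

(** A rectangle is padded with full sides up to a length below which [s] acts as a permutation. Its
    preimage is then the rectangle with permuted sides, and the product of their measures is
    commutative. *)
Lemma exchangeable_infinite_product (r : probability X R) :
  exchangeable (infinite_product (fun=> r)).
Proof.
move=> s B mB; have ms := @measurable_permute _ X s.
apply: (infinite_product_unique (P := image_prob ms (infinite_product (fun=>
  r)))) => //.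
move=> n C mC; have [N sN] := finperm_bound s; have [sK Ks] := finperm_invP s.
have s'N i : (N <= i)%N -> (s^-1)%g i = i by move=> Ni;
  rewrite -{1}(sN i Ni) sK.
pose m := maxn n N; pose C' i := if (i < n)%N then C i else setT.
have mC' i : measurable (C' i) by rewrite /C'; case: ifP.
have CC' : [set x : ipower X | forall i, (i < n)%N -> C i (x i)] =
           [set x | forall i, (i < m)%N -> C' i (x i)].
  apply/seteqP; split => x /= h i ii; first by rewrite /C'; case: ifP => // /h.
  by have := h i (leq_trans ii (leq_maxl _ _)); rewrite /C' ii.
rewrite image_probE -(infinite_productE (fun=> r) n mC) CC'.
rewrite (_ : _ @^-1` _ = [set x | forall j, (j < m)%N -> C' (s j) (x j)]).
  rewrite (infinite_productE _ m (fun j =>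
    mC' (s j))) (infinite_productE _ m mC').
  apply: (@finperm_big _ _ (mule : Monoid.com_law 1) s N sN m (fun i =>
    r (C' i))).
  exact: leq_maxr.
apply/seteqP; split => x /= h i im.
  have := h (s i) (finperm_lt sN (leq_maxr _ _) im).
  by rewrite /permute [(s^-1)%g _]sK.
have := h ((s^-1)%g i) (finperm_lt s'N (leq_maxr _ _) im).
by rewrite [s _]Ks.
Qed.

End exchangeable_product.

(** * The directing measure over the Cantor space *)

Section directing_bits.
Local Notation C := (ipower bool).
Context (R : realType).
Implicit Types (x : ipower C) (s : seq bool).

Definition freqs x : ipower R :=
  fun n => oapp (fun s => lim_freq (cyl s) x) 0%R (unpickle n).

Lemma mass_freqs x s : mass (freqs x) s = lim_freq (cyl s) x.
Proof. by rewrite /mass /freqs pickleK. Qed.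

Lemma measurable_freqs : measurable_fun setT freqs.
Proof.
apply: measurable_fun_ipower => n; rewrite /freqs;
  case: (unpickle n) => [s|] //=.
by have [] := @bmeas_lim_freq _ _ R _ (measurable_cyl s).
Qed.

(** Defined for every [x]: even when the frequencies are inconsistent, [tree_law] is a probability
    measure, only with unspecified masses. *)
Definition directing x : pspace C R := tree_law (freqs x).

Lemma measurable_directing : measurable_fun setT directing.
Proof. exact: (measurableT_comp (@measurable_tree_law R) measurable_freqs). Qed.

(** The index starts at 1 because the frequency among no terms is 0 by convention. *)
Lemma lim_freq_unique (A : set C) x (l : R) :
  (forall n, freq A n.+1 x = l) -> lim_freq A x = l.
Proof.
move=> h; have E k : freq A (4 ^ k)%N x = l.
  by rewrite -(@prednK (4 ^ k)) ?expn_gt0.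
have cf : freq A (4 ^ k)%N x @[k --> \oo] --> l.
  by under eq_fun do rewrite E; exact: cvg_cst.
apply: (cvg_unique _ _ cf); first exact: Rhausdorff.
by apply: lim_freq_cvg; apply/cvg_ex; exists l.
Qed.

Lemma lim_freq0 x : lim_freq set0 x = 0%R :> R.
Proof.
apply: lim_freq_unique => n; rewrite /freq big1 ?mulr0// => i _.
by rewrite /hit indic0.
Qed.

Lemma lim_freqT x : lim_freq setT x = 1%R :> R.
Proof.
apply: lim_freq_unique => n; rewrite /freq.
under eq_bigr do rewrite /hit indicT.
by rewrite sumr_const card_ord mulVf// pnatr_eq0.
Qed.

Lemma freq_cyl_rcons n s x : (freq (cyl s) n x =
  freq (cyl (rcons s false)) n x + freq (cyl (rcons s true)) n x :> R)%R.
Proof.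
rewrite /freq -mulrDr -big_split/=; congr (_ * _)%R; apply: eq_bigr => i _.
rewrite /hit !indicE [in LHS]cyl_rcons in_setU.
have [x0|x0] := boolP (x i \in cyl (rcons s false)); last by rewrite add0r.
have [x1|x1] := boolP (x i \in cyl (rcons s true)); last by rewrite addr0.
have : (cyl (rcons s false) `&` cyl (rcons s true)) (x i) by split;
  exact: set_mem.
by rewrite cyl_rcons_disj.
Qed.

Section exchangeable.
Variables (p : probability (ipower C) R).
Hypothesis hp : exchangeable p.

(** Additivity is exact for finite frequencies and passes to genuine limits, though not to upper
    limits; hence the restriction to points where the frequencies of all the countably many
    cylinders converge. *)
Lemma ae_consistent_freqs : {ae p, forall x, consistent (freqs x)}.
Proof.
pose Q n x := if unpickle n is Some s then
  (freq (cyl s) (4 ^ k)%N x : R) @[k --> \oo] --> lim_freq (cyl s) x else True.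
have h : {ae p, forall x n, Q n x}.
  apply/ae_foralln => n; rewrite /Q; case: (unpickle n) => [s|];
    last exact: aeW.
  exact: (ae_freq_cvg hp (measurable_cyl s)).
apply: filterS h => x h.
have {}h s : (freq (cyl s) (4 ^ k)%N x : R) @[k --> \oo] --> lim_freq (cyl s) x.
  by have := h (pickle s); rewrite /Q pickleK.
split=> [|s|s]; rewrite !mass_freqs ?lim_freq_ge0//.
  rewrite (_ : cyl [::] = setT) ?lim_freqT//.
  by apply/seteqP; split.
have e : (fun k => freq (cyl s) (4 ^ k)%N x : R) =
    ((fun k => freq (cyl (rcons s false)) (4 ^ k)%N x) \+
     (fun k => freq (cyl (rcons s true)) (4 ^ k)%N x))%R.
  by apply/funext => k; exact: freq_cyl_rcons.
apply: (cvg_unique (@Rhausdorff R) (h s)); rewrite e.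
by apply: cvgD; exact: h.
Qed.

Lemma ae_directing_cyls :
  {ae p, forall x A, cyls A -> directing x A = (lim_freq A x)%:E}.
Proof.
apply: filterS ae_consistent_freqs => x cx A [->|[s ->]].
  by rewrite measure0 lim_freq0.
by rewrite tree_law_cyl// mass_freqs.
Qed.

(** Both sides are probability measures in [B], so it suffices to compare rectangles with cylinder
    sides; there the i.i.d. law is almost surely a product of limiting frequencies, whose
    expectation is known. *)
Lemma directing_mixture B : measurable B ->
  \int[p]_x iid (directing x) B = p B.
Proof.
move=> mB; pose q := image_prob measurable_directing p.
have w1 : \int[q]_r (1%R)%:E = 1.
  by rewrite integral_cst// mul1e; exact: (@probability_setT _ _ _ q).
have w0 (r : pspace C R) : (0 <= 1 :> R)%R by exact: ler01.
pose Q := @mixture _ _ _ _ _ q (fun=> 1%R) iid (measurable_cst _) w0 w1.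
have QE D : measurable D -> Q D = \int[p]_x iid (directing x) D.
  move=> mD; rewrite [LHS]mixtureE; under eq_integral do rewrite mul1e.
  by rewrite ge0_integral_image_prob//; exact: measurable_kernel.
rewrite -QE//; apply: (@probability_unique _ _ _ Q p (rects_of cyls)) => //.
- exact: (rects_of_gen cylsT cyls_gen).
- exact: (rects_ofI cylsI cylsT).
- exact: (rects_ofT cylsT).
move=> _ [n [D [cD ->]]]; have mD i : measurable (D i) by exact:
  measurable_cyls.
have [mr _] := cylinder_rect n mD.
rewrite QE// (exchangeable_rect hp n mD); apply: ae_eq_integral => //.
- exact: (measurableT_comp (measurable_kernel iid _ mr) measurable_directing).
- apply/measurable_EFinP.
  have [] // : bmeas (fun x : ipower C =>
    \prod_(0 <= i < n) lim_freq (D i) x : R)%R.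
  by apply: bmeas_prod => i; exact: bmeas_lim_freq.
- apply: filterS ae_directing_cyls => x xD _.
  rewrite iidE// infinite_productE//.
  by rewrite big_mkord -prodEFin; apply: eq_bigr => i _; rewrite xD.
Qed.

End exchangeable.

Lemma ae_directing_iid (r : pspace C R) :
  {ae infinite_product (fun=> r : probability C R), forall x, directing x = r}.
Proof.
set p := infinite_product _.
have hp : exchangeable p by exact: exchangeable_infinite_product.
have key A : measurable A -> {ae p, forall x, lim_freq A x = fine (r A)}.
  move=> mA; have mcA (i : nat) : measurable ((fun=> A) i : set C) by [].
  (* Rectangles with one and two sides equal to [A] give the first two moments of the limiting
     frequency; the variance is then 0. *)
  have bl := @bmeas_lim_freq _ _ R _ mA.
  have rA : r A = (fine (r A))%:E by rewrite fineK// fin_num_measure.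
  have E1 : (\int[p]_x lim_freq A x = fine (r A))%R.
    apply: EFin_inj; rewrite -rA -(bmeas_EFin p bl).
    have := etrans (esym (infinite_productE (fun=> r : probability C R) 1 mcA))
      (@exchangeable_rect _ _ _ p hp (fun=> A) 1 mcA).
    rewrite big_ord_recl big_ord0 mule1 => ->.
    by apply: eq_integral => x _; rewrite big_nat1.
  have E2 : (\int[p]_x (lim_freq A x * lim_freq A x)
    = fine (r A) * fine (r A))%R.
    apply: EFin_inj; rewrite EFinM -rA -(bmeas_EFin p (bmeasM bl bl)).
    have := etrans (esym (infinite_productE (fun=> r : probability C R) 2 mcA))
      (@exchangeable_rect _ _ _ p hp (fun=> A) 2 mcA).
    rewrite !big_ord_recl big_ord0 mule1 => ->.
    by apply: eq_integral => x _; rewrite big_nat_recr//= big_nat1.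
  set a := fine (r A) in E1 E2 *.
  have bd : bmeas (fun x : ipower C => lim_freq A x - a)%R.
    by apply: bmeasB => //; exact: bmeas_cst.
  have : {ae p, forall x, ((lim_freq A x - a) * (lim_freq A x - a) = 0)%R}.
    apply: (E_eq0_ae (bmeasM bd bd)) => [x|]; first by rewrite -expr2 sqr_ge0.
    transitivity (\int[p]_x (lim_freq A x * lim_freq A x + (- 2 * a * lim_freq
      A x + a * a)))%R.
      by apply: eq_Rintegral => x _; ring.
    rewrite ED; [|exact: bmeasM|by apply: bmeasD;
      [exact: bmeasZ|exact: bmeas_cst]].
    rewrite ED; [|exact: bmeasZ|exact: bmeas_cst].
    by rewrite EZ// Ecst E1 E2; ring.
  by apply: filterS => x /eqP; rewrite mulf_eq0 orbb subr_eq0 => /eqP.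
have h : {ae p, forall x, forall n, freqs x n = masses r n}.
  apply/ae_foralln => n; rewrite /freqs /masses.
  case: (unpickle n) => [s|] /=; last exact: aeW.
  exact: key (measurable_cyl s).
apply: filterS h => x h; rewrite /directing (_ : freqs x = masses r).
  exact: masses_tree_law.
exact/funext.
Qed.

End directing_bits.

(** * The limit cone *)

Lemma mretract_pspace (R : realType) d d' (X : measurableType d)
    (Y : measurableType d') :
  mretract X Y -> mretract (pspace X R) (pspace Y R).
Proof.
move=> [c [l [mc ml cl]]]; exists (pmap mc), (pmap ml); split.
- exact: measurable_pmap.
- exact: measurable_pmap.
move=> r; apply: pspace_eq => A mA.
have mlA : measurable (l @^-1` A) by exact: mset_preimage ml mA.
rewrite pmapE// pmapE// -comp_preimage (_ : l \o c = id)//.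
by apply/funext => x; exact: cl.
Qed.

Lemma standard_borel_ipower (R : realType) d (X : measurableType d) :
  standard_borel R X -> standard_borel R (ipower X).
Proof.
move=> /standard_borelP hX; apply/standard_borelP.
exact: (mretract_trans (mretract_ipower hX) (mretract_ipower2 nat)).
Qed.

Lemma mretract_bits (R : realType) d (X : measurableType d) :
  standard_borel R X -> mretract X (ipower bool).
Proof.
by move=> /standard_borelP hX; exact: mretract_trans hX mretract_nat_bool.
Qed.

Lemma standard_borel_pspace (R : realType) d (X : measurableType d) :
  standard_borel R X -> standard_borel R (pspace X R).
Proof.
move=> /mretract_bits /(mretract_pspace R) hX; apply/standard_borelP.
have hR : mretract R (ipower nat) by
  exact/standard_borelP/standard_borel_realType.
apply: mretract_trans hX _.
apply: mretract_trans (mretract_trans (mretract_ipower hR) (mretract_ipower2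
  nat)).
exists (@masses R), (@tree_law R); split.
- exact: measurable_masses.
- exact: measurable_tree_law.
- exact: masses_tree_law.
Qed.

Section directing.
Context (R : realType) d (X : measurableType d).

(* F reads off from a sequence the law of its terms: it inverts iid, and makes
   iid a section of itself on exchangeable laws *)
Definition directs (F : ipower X -> pspace X R) : Prop :=
  [/\ measurable_fun setT F,
      forall r B, measurable B -> iid r (F @^-1` B) = \d_r B &
      forall p : probability (ipower X) R, exchangeable p ->
        forall B, measurable B -> \int[p]_x iid (F x) B = p B].

Lemma ex_directs : standard_borel R X -> exists F, directs F.
Proof.
move=> /mretract_bits[c [l [mc ml cl]]].
(* The terms are coded as bit sequences, the directing measure is taken there, and the result is
   pushed back by the retraction. *)
pose F (x : ipower X) : pspace X R := pmap ml (directing R (imap c x)).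
have mcN := measurable_imap mc; have mlN := measurable_imap ml.
have mD := @measurable_directing R.
have mF : measurable_fun setT F.
  apply: (measurableT_comp (measurable_pmap ml)).
  exact: (measurableT_comp mD mcN).
have lcK : imap l \o imap c = id.
  by apply/funext => x; apply/funext => i; exact: cl.
exists F; split=> //.
- move=> r B mB.
  have mFB : measurable (F @^-1` B) by exact: mset_preimage mF mB.
  pose B' := pmap ml @^-1` B.
  have mB' : measurable B' by exact: mset_preimage (measurable_pmap ml) mB.
  pose P := infinite_product (fun=> pmap mc r : probability _ R).
  have mDB : measurable (directing R @^-1` B') by exact: mset_preimage mD mB'.
  apply: (etrans (iidE r mFB));
    apply: (etrans (esym (infinite_product_pmap mc r mDB))).
  transitivity (\int[P]_x (\1_B' (directing R x))%:E).
    rewrite (_ : (fun x => _) = (fun x => (\1_(directing R @^-1` B') x)%:E)) //.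
    by rewrite integral_indic// setIT.
  transitivity (\int[P]_x (\1_B' (pmap mc r))%:E).
    apply: ae_eq_integral => //.
    - apply/measurable_EFinP.
      have mI : measurable_fun setT (\1_B' : _ -> R) by exact: measurable_indic.
      exact: (measurableT_comp mI mD).
    - by apply: filterS (ae_directing_iid (pmap mc r)) => x -> _.
  transitivity ((\1_B' (pmap mc r) : R)%:E).
    by rewrite integral_cst// -[RHS]mule1; congr (_ * _);
      exact: probability_setT.
  rewrite /dirac !indicE; congr (_%:R%:E); congr nat_of_bool.
  have e : pmap ml (pmap mc r) = r.
    apply: pspace_eq => A mA.
    have mlA : measurable (l @^-1` A) by exact: mset_preimage ml mA.
    rewrite pmapE// pmapE// -comp_preimage (_ : l \o c = id)//.
    by apply/funext => x; exact: cl.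
  by rewrite -[in RHS]e; apply/idP/idP => /set_mem h; apply/mem_set.
- move=> p hp B mB.
  have mB' : measurable (imap l @^-1` B) by exact: mset_preimage mlN mB.
  have hp' := exchangeable_imap mc hp.
  transitivity (\int[p]_x iid (directing R (imap c x)) (imap l @^-1` B)).
    by apply: eq_integral => x _; rewrite !iidE// infinite_product_pmap.
  rewrite -(ge0_integral_image_prob mcN p
    (h := fun y => iid (directing R y) (imap l @^-1` B)))//.
    by rewrite directing_mixture// image_probE -comp_preimage lcK.
  exact: (measurableT_comp (measurable_kernel iid _ mB') mD).
Qed.

End directing.

(* ssrfun.pcomp would shadow the composition of kernels *)
Local Notation pcomp := Defs.pcomp.

Section pcomp_facts.
Context d d1 d2 (Y : measurableType d) (Z : measurableType d1)
  (W : measurableType d2) (R : realType).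

Lemma pcomp_kdirac (f : Z -> W) (mf : measurable_fun setT f)
    (g : R.-pker Y ~> Z) y B : measurable B ->
  pcomp (kdirac mf) g y B = g y (f @^-1` B).
Proof.
move=> mB; rewrite pcompE.
rewrite (_ : (fun z => _) = (fun z => (\1_(f @^-1` B) z)%:E)) //.
by rewrite integral_indic ?setIT//; exact: mset_preimage mf mB.
Qed.

Lemma as_eqW (q : probability Y R) (g h : R.-pker Y ~> Z) :
  (forall y B, measurable B -> g y B = h y B) -> as_eq q g h.
Proof. by move=> gh A B mA mB; apply: eq_integral => y _; exact: gh. Qed.

End pcomp_facts.

(** * The universal property *)

Section directed_limit.
Context (R : realType) d (X : measurableType d).
Variables (F : ipower X -> pspace X R).
Hypothesis dF : directs F.

Let mF : measurable_fun setT F. Proof. by have [] := dF. Qed.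

Let mFB B : measurable B -> measurable (F @^-1` B).
Proof. by move=> mB; exact: mset_preimage mF mB. Qed.

(* q conditioned on A has density (q A)^-1 \1_A; mixing g against it yields an
   exchangeable law, to which the defining property of F applies. *)
Lemma directing_as_eq d' (Y : measurableType d') (q : probability Y R)
    (g : R.-pker Y ~> ipower X) :
  (forall s, as_eq q (pcomp (perm_action X R s) g) g) ->
  forall A B, measurable A -> measurable B ->
    \int[q]_(y in A) \int[g y]_x iid (F x) B = \int[q]_(y in A) g y B.
Proof.
move=> inv A B mA mB.
have mh : measurable_fun setT (fun x => iid (F x) B).
  exact: (measurableT_comp (measurable_kernel iid _ mB) mF).
have mi : measurable_fun setT (fun y => \int[g y]_x iid (F x) B).
  by apply: measurable_fun_integral_kernel => //; exact: measurable_kernel.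
have mg C : measurable C -> measurable_fun setT (fun y => g y C).
  by move=> mC; exact: measurable_kernel.
(* Conditioning on a null event is impossible, but then both integrals vanish. *)
have [qA0|qA0] := eqVneq (q A) 0.
  rewrite !null_set_integral//; first exact: measurable_funTS (mg _ mB).
  exact: measurable_funTS mi.
have qA_fin : q A \is a fin_num by exact: fin_num_measure.
have qA_gt0 : (0 < fine (q A))%R.
  by rewrite fine_gt0// lt0e qA0 measure_ge0 ltey_eq qA_fin.
pose c := ((fine (q A))^-1)%R.
have c0 : (0 < c)%R by rewrite invr_gt0.
pose w (y : Y) := (c * \1_A y)%R.
have mw : measurable_fun setT w.
  by apply: measurable_funM => //; exact: measurable_indic.
have w0 y : (0 <= w y)%R by rewrite mulr_ge0 ?(ltW c0)// indicE.
have wint (f : Y -> \bar R) : measurable_fun setT f -> (forall y, 0 <= f y) ->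
    \int[q]_y ((w y)%:E * f y) = c%:E * \int[q]_(y in A) f y.
  move=> mf f0; rewrite [in RHS]integral_mkcond.
  have mfA : measurable_fun setT (f \_ A).
    by apply/(measurable_restrictT _ _).1 => //; exact: measurable_funTS mf.
  rewrite -ge0_integralZl//; last 2 first.
  - by move=> y _; rewrite patchE; case: ifP.
  - by rewrite lee_fin ltW.
  apply: eq_integral => y _; rewrite /w EFinM -muleA patchE indicE.
  by case: (y \in A); rewrite ?mul1e ?mul0e.
have w1 : \int[q]_y (w y)%:E = 1.
  transitivity (\int[q]_y ((w y)%:E * 1)).
    by apply: eq_integral => y _; rewrite mule1.
  transitivity (c%:E * q A); first by rewrite wint// integral_cst// mul1e.
  by rewrite -(fineK qA_fin) -EFinM mulVf// gt_eqF.
pose Q := mixture g mw w0 w1.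
have QE C : measurable C -> Q C = c%:E * \int[q]_(y in A) g y C.
  by move=> mC; rewrite [LHS]mixtureE wint//; exact: mg.
(* Almost sure invariance of [g], tested on the event [A], is precisely exchangeability of the
   conditioned law. *)
have hQ : exchangeable Q.
  move=> s C mC; have msC := mset_preimage (@measurable_permute _ X s) mC.
  rewrite QE// QE//; congr (_ * _); rewrite -(inv s A C mA mC).
  by apply: eq_integral => y _; rewrite pcomp_kdirac.
have [_ _ /(_ Q hQ B mB)] := dF.
rewrite QE// integral_mixture// wint//; last by move=> y; exact: integral_ge0.
move=> /(congr1 (fun e => (fine (q A))%:E * e)).
by rewrite !muleA -!EFinM mulfV ?gt_eqF// !mul1e.
Qed.

(** For uniqueness of the measure, integrating [iid r (F @^-1]
    A)[, the indicator of]A[at]r[, against]nu[gives]nu A[on one side and]p (F @^-1[A)] on the other.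
    The same computation, carried out under the integral over an event of the source, determines a
    factorisation [h] of the cone. *)
Lemma directs_limit (p : probability (ipower X) R) : standard_borel R X ->
  exchangeable p ->
  exists mu : probability (pspace X R) R,
    [/\ ps_hom mu p iid,
        forall nu : probability (pspace X R) R, ps_hom nu p iid ->
          forall A, measurable A -> nu A = mu A &
        ps_limit p (perm_action X R) mu iid].
Proof.
move=> hX hp; have [_ Fiid Fp] := dF.
pose mu := image_prob mF p.
have mu_hom : ps_hom mu p iid.
  move=> B mB; rewrite /kapp ge0_integral_image_prob//; first exact: Fp.
  exact: measurable_kernel.
have Fdirac (r : pspace X R) B : measurable B -> iid r (F @^-1` B)
  = (\1_B r)%:E.
  by move=> mB; rewrite Fiid.
exists mu; split=> //.
  move=> nu hnu A mA; apply: esym; apply: (etrans (esym (hnu _ (mFB mA)))).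
  rewrite /kapp; under eq_integral do rewrite Fdirac//.
  by rewrite integral_indic// setIT.
split.
  split=> //; first exact: standard_borel_pspace.
  move=> s; apply: as_eqW => r B mB; rewrite pcomp_kdirac//.
  have msB := mset_preimage (@measurable_permute _ X s) mB.
  apply: (etrans (iidE r msB)); apply: (etrans _ (esym (iidE r mB))).
  exact: exchangeable_infinite_product.
move=> d'' Y q g [sY qg inv].
exists (pcomp (kdirac mF) g); split.
- move=> B mB; rewrite /kapp; under eq_integral do rewrite pcomp_kdirac//.
  exact: (qg _ (mFB mB)).
- move=> A B mA mB; rewrite -(directing_as_eq inv mA mB).
  apply: eq_integral => y _; rewrite pcompE.
  rewrite (eq_measure_integral (pushforward (g y) F)); last first.
    by move=> C mC _; rewrite pcomp_kdirac.
  by rewrite ge0_integral_pushforward//; exact: measurable_kernel.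
- move=> h qh hg A B mA mB.
  transitivity (\int[q]_(y in A) g y (F @^-1` B)).
    by apply: eq_integral => y _; rewrite pcomp_kdirac.
  rewrite -(hg A _ mA (mFB mB)); apply: eq_integral => y _; rewrite pcompE.
  under eq_integral do rewrite Fdirac//.
  by rewrite integral_indic// setIT.
Qed.

End directed_limit.

Theorem corollary4p3 (R : realType) (d : measure_display) (X : measurableType d)
    (hX : standard_borel R X)
    (p : probability (ipower X) R) (hp : exchangeable p) :
  ps_dyn_system p (perm_action X R) /\
  exists mu : probability (pspace X R) R,
    [/\ ps_hom mu p iid,
        forall nu : probability (pspace X R) R, ps_hom nu p iid ->
          forall A, measurable A -> nu A = mu A &
        ps_limit p (perm_action X R) mu iid].
Proof.
split; last by have [F dF] := ex_directs hX; exact: (directs_limit dF).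
split.
- exact: standard_borel_ipower.
- exact/exchangeableP.
- by apply: as_eqW => x B _; exact: perm_action1.
- by move=> s t; apply: as_eqW => x B mB; exact: perm_actionM.
Qed.
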